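(* Let $G$ be a simple graph whose $n$ vertices are listed as $(v_1,\dots,v_n)$ in a greedy ordering, and let $d = n - \deg(v_n)$. Then uniform LSS on $(v_1,\dots,v_n)$ in $\mathbb{R}^d$ succeeds strongly.
   Context: Greedy ordering: for an ordering $(v_1,\dots,v_n)$ of $V(G)$ and $1\le i\le j\le n$, the local degree of $v_j$ at stage $i$ is $|\{h<i : v_hv_j\in E(G)\}|$. The ordering is greedy (a maximum cardinality search ordering) if for all $1\le i\le j\le n$ the local degree of $v_i$ at stage $i$ is at least the local degree of $v_j$ at stage $i$. Uniform LSS: fix an ordering $(v_1,\dots,v_n)$ and a dimension $d$. For each $j$ let $W_j$ be the list, in the given order, of those $v_i$ with $i<j$ and $v_i$ not adjacent to $v_j$. Vectors $\varphi(v_1),\dots,\varphi(v_n)\in\mathbb{R}^d$ are chosen in order: if the vectors $\varphi(w)$, $w\in W_j$, are linearly dependent, or if $|W_j|\ge d$, set $\varphi(v_j)=\mathbf 0$; otherwise choose $\varphi(v_j)$ uniformly at random from the unit sphere of the orthogonal complement $S_j$ of the span of $\{\varphi(w): w\in W_j\}$. Uniform LSS succeeds weakly if with probability $1$ every $\varphi(v_j)$ is nonzero. It succeeds strongly if it succeeds weakly and, for every pair $i<j$ with $v_i$ adjacent to $v_j$, with probability $1$ the vectors $\varphi(w)$ ($w\in W_j$) together with $\varphi(v_i)$ are linearly independent. *)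

(* Defs.v *)
From HB Require Import structures.
From mathcomp Require Import all_boot all_order all_algebra.
From mathcomp Require Import all_classical all_reals all_analysis.
Set Implicit Arguments.
Unset Strict Implicit.
Unset Printing Implicit Defensive.

Import Order.TTheory GRing.Theory Num.Theory.
Import numFieldNormedType.Exports.
Local Open Scope classical_set_scope.
Local Open Scope ring_scope.

(* Throughout, a simple graph is a symmetric irreflexive [e : rel T] on a
   finite type, and v_1, ..., v_n is [v 0, ..., v (n - 1)]. Since [h < i] and
   [i <= j] only compare positions, 0-based numbering changes nothing below. *)

Definition degree (T : finType) (e : rel T) (x : T) : nat :=
  #|[set y : T | e x y]%SET|.

Definition local_degree (T : finType) (e : rel T) (n : nat) (v : 'I_n -> T)
    (i j : 'I_n) : nat :=
  #|[set h : 'I_n | (h < i)%N && e (v h) (v j)]%SET|.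

Definition greedy_ordering (T : finType) (e : rel T) (n : nat)
    (v : 'I_n -> T) : Prop :=
  forall i j : 'I_n, (i <= j)%N ->
    (local_degree e v i j <= local_degree e v i i)%N.

(* The Borel sigma-algebra of R^d, generated by the coordinates as for the
   library's tuples. *)
Section row_vector_measurable.
Variables (R : realType) (d : nat).

Let coord_rV (k : 'I_d) (x : 'rV[R]_d) : measurableTypeR R := x ord0 k.

Definition measurable_rV : set (set 'rV[R]_d) := g_sigma_preimage coord_rV.

Let measurable_rV0 : measurable_rV set0.
Proof. exact: sigma_algebra0. Qed.

Let measurable_rVC A : measurable_rV A -> measurable_rV (~` A).
Proof. exact: sigma_algebraC. Qed.

Let measurable_rV_bigcup (F : (set 'rV[R]_d)^nat) :
  (forall i, measurable_rV (F i)) -> measurable_rV (\bigcup_i F i).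
Proof. exact: sigma_algebra_bigcup. Qed.

HB.instance Definition _ := @isMeasurable.Build (sigma_display measurable_rV)
  'rV[R]_d measurable_rV measurable_rV0 measurable_rVC measurable_rV_bigcup.

End row_vector_measurable.

(* The norm `|x| that the library puts on row vectors is the sup norm, so
   Euclidean notions are expressed through the dot product. *)
Definition dot (R : realType) (d : nat) (x y : 'rV[R]_d) : R :=
  \sum_(k < d) x ord0 k * y ord0 k.

Definition orthogonal_complement (R : realType) (d : nat)
    (ws : seq 'rV[R]_d) : set 'rV[R]_d :=
  [set x | forall w, w \in <<ws>>%VS -> dot w x = 0].

Definition unit_sphere (R : realType) (d : nat) (S : set 'rV[R]_d) :
    set 'rV[R]_d :=
  [set x | S x /\ dot x x = 1].

(* For a linear subspace S <> 0, the uniform distribution on the unit sphere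
   of S is the unique probability measure carried by that sphere and invariant
   under the orthogonal group of S. Every orthogonal map of S is the
   restriction of an orthogonal map x |-> x Q of R^d that preserves S. *)
Definition uniform_on_unit_sphere (R : realType) (d : nat)
    (S : set 'rV[R]_d) (mu : set 'rV[R]_d -> \bar R) : Prop :=
  mu (unit_sphere S) = 1%E /\
  forall Q : 'M[R]_d, Q *m Q^T = 1%:M -> (mulmxr Q) @` S = S ->
    forall B : set 'rV[R]_d, measurable B -> mu ((mulmxr Q) @^-1` B) = mu B.

(* The position i < j seen among all n positions. *)
Definition earlier (n : nat) (j : 'I_n) : 'I_j -> 'I_n :=
  widen_ord (ltnW (ltn_ord j)).

(* W_j, as the increasing list of positions. *)
Definition earlier_nonneighbours (T : finType) (e : rel T) (n : nat)
    (v : 'I_n -> T) (j : 'I_n) : seq 'I_j :=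
  [seq i <- enum 'I_j | ~~ e (v (earlier i)) (v j)].

(* [mu] is the law from which the vector of v_j is drawn once the vectors
   [h] of v_1, ..., v_(j-1) have been chosen. *)
Definition lss_step_law (R : realType) (d : nat) (T : finType) (e : rel T)
    (n : nat) (v : 'I_n -> T) (j : 'I_n) (h : j.-tuple 'rV[R]_d)
    (mu : set 'rV[R]_d -> \bar R) : Prop :=
  let ws := [seq tnth h i | i <- earlier_nonneighbours e v j] in
  if ~~ free ws || (d <= size ws)%N
  then mu [set 0] = 1%E
  else uniform_on_unit_sphere (orthogonal_complement ws) mu.

Definition past (R : realType) (d n : nat) (Omega : Type)
    (phi : 'I_n -> Omega -> 'rV[R]_d) (j : 'I_n) (omega : Omega) :
    j.-tuple 'rV[R]_d :=
  [tuple phi (earlier i) omega | i < j].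

(* The random vectors [phi 0, ..., phi (n - 1)] are an outcome of uniform LSS
   when, for each j, the conditional distribution of [phi j] given the earlier
   vectors is the step law above, i.e. is given by a Markov kernel [K] whose
   value at each history is that law. *)
Definition uniform_LSS (R : realType) (d : nat) (T : finType) (e : rel T)
    (n : nat) (v : 'I_n -> T) (disp : measure_display)
    (Omega : measurableType disp) (P : probability Omega R)
    (phi : 'I_n -> {RV P >-> 'rV[R]_d}) : Prop :=
  forall j : 'I_n,
    exists K : R.-pker (j.-tuple 'rV[R]_d) ~> 'rV[R]_d,
      (forall h : j.-tuple 'rV[R]_d, lss_step_law e v h (K h)) /\
      (forall (A : set (j.-tuple 'rV[R]_d)) (B : set 'rV[R]_d),
         measurable A -> measurable B ->
         P ((past phi j @^-1` A) `&` (phi j @^-1` B)) =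
         (\int[P]_(omega in past phi j @^-1` A) K (past phi j omega) B)%E).

Definition succeeds_weakly (R : realType) (d n : nat)
    (disp : measure_display) (Omega : measurableType disp)
    (P : probability Omega R) (phi : 'I_n -> {RV P >-> 'rV[R]_d}) : Prop :=
  {ae P, forall omega, forall j : 'I_n, phi j omega != 0}.

Definition succeeds_strongly (R : realType) (d : nat) (T : finType)
    (e : rel T) (n : nat) (v : 'I_n -> T) (disp : measure_display)
    (Omega : measurableType disp) (P : probability Omega R)
    (phi : 'I_n -> {RV P >-> 'rV[R]_d}) : Prop :=
  succeeds_weakly phi /\
  forall i j : 'I_n, (i < j)%N -> e (v i) (v j) ->
    {ae P, forall omega,
      free (rcons [seq phi (earlier w) omega | w <- earlier_nonneighbours e v j]
                  (phi i omega))}.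

(* Main.v *)
Require Import Defs.
From HB Require Import structures.
From mathcomp Require Import all_boot all_order all_algebra.
From mathcomp Require Import all_classical all_reals all_analysis.
From mathcomp Require Import measurable_realfun.
From mathcomp Require Import ring zify.
Set Implicit Arguments.
Unset Strict Implicit.
Unset Printing Implicit Defensive.

Import Order.TTheory GRing.Theory Num.Theory.
Import numFieldNormedType.Exports.
Local Open Scope classical_set_scope.
Local Open Scope ring_scope.

(** Let W_j be the earlier non-neighbours of v_j, and call (x_i)_{i < m} a
    representation in R^d if x_j is orthogonal to the independent family x_{W_j}
    for every j < m.

    Since x_j is an arbitrary vector of a space that depends polynomially on the
    previous ones, representations form an irreducible variety, and a
    scale-invariant Zariski-open condition met by one representation is met
    almost surely by uniform LSS.  It remains to produce, for A = W_j together
    with one earlier neighbour, a representation with x_A independent.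

    This works for every set A of positions < m with |A| <= d and
    |W_i| <= |A cap [0, i)| for all i < m (a property of each W_j and of its
    supersets, because the ordering is greedy), by induction on m.  If the last
    position k = m - 1 lies in A, put A' = A \ {k}; a new vector x_k can be chosen
    outside the span of x_{A'} once the Gram matrix of x_{W_k} against x_{A'} has
    independent rows.  This condition only involves scalar products, so it may be
    checked in the smaller dimension |A'|, where it says that x_{W_k} is
    independent and x_{A'} is a basis: both follow by induction, as
    |W_k| <= |A'|. *)

(** * Polynomial functions and Zariski-open conditions *)

Section PolynomialFunctions.
Variable R : realType.

(** The generating class is a parameter: below it consists of coordinates, of the identity of the
    line ([eq id]), or of all measurable functions. *)
Inductive polyfun (X : Type) (C : (X -> R) -> Prop) : (X -> R) -> Prop :=
| polyfun_gen f : C f -> polyfun C f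
| polyfun_cst c : polyfun C (fun=> c)
| polyfun_add f g :
    polyfun C f -> polyfun C g -> polyfun C (fun x => f x + g x)
| polyfun_mul f g :
    polyfun C f -> polyfun C g -> polyfun C (fun x => f x * g x).

Lemma eq_polyfun X (C : (X -> R) -> Prop) f g :
  f =1 g -> polyfun C f -> polyfun C g.
Proof. by move=> /funext ->. Qed.

Lemma polyfun_opp X (C : (X -> R) -> Prop) f :
  polyfun C f -> polyfun C (fun x => - f x).
Proof.
move=> /(polyfun_mul (polyfun_cst C (-1))); apply: eq_polyfun => x.
by rewrite mulN1r.
Qed.

Lemma polyfun_sum X (C : (X -> R) -> Prop) I (r : seq I) (P : pred I) F :
  (forall i, P i -> polyfun C (F i)) ->
  polyfun C (fun x => \sum_(i <- r | P i) F i x).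
Proof.
move=> PF; elim: r => [|i r IH].
  by apply: eq_polyfun (polyfun_cst C 0) => x; rewrite big_nil.
have [Pi|nPi] := boolP (P i).
  by apply: eq_polyfun (polyfun_add (PF _ Pi) IH) => x; rewrite big_cons Pi.
by apply: eq_polyfun IH => x; rewrite big_cons (negPf nPi).
Qed.

Lemma polyfun_prod X (C : (X -> R) -> Prop) I (r : seq I) (P : pred I) F :
  (forall i, P i -> polyfun C (F i)) ->
  polyfun C (fun x => \prod_(i <- r | P i) F i x).
Proof.
move=> PF; elim: r => [|i r IH].
  by apply: eq_polyfun (polyfun_cst C 1) => x; rewrite big_nil.
have [Pi|nPi] := boolP (P i).
  by apply: eq_polyfun (polyfun_mul (PF _ Pi) IH) => x; rewrite big_cons Pi.
by apply: eq_polyfun IH => x; rewrite big_cons (negPf nPi).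
Qed.

Lemma polyfun_det X (C : (X -> R) -> Prop) n (A : X -> 'M[R]_n) :
  (forall i j, polyfun C (fun x => A x i j)) ->
  polyfun C (fun x => \det (A x)).
Proof.
move=> PA; rewrite /determinant; apply: polyfun_sum => s _.
by apply: polyfun_mul (polyfun_cst _ _) _; apply: polyfun_prod.
Qed.

Lemma polyfun_comp X Y (C : (X -> R) -> Prop) (D : (Y -> R) -> Prop)
    (g : Y -> X) f :
  (forall h, C h -> polyfun D (h \o g)) -> polyfun C f -> polyfun D (f \o g).
Proof.
move=> gP; elim=> {f} [f /gP//|c|f h _ IHf _ IHh|f h _ IHf _ IHh].
- exact: polyfun_cst.
- exact: polyfun_add IHf IHh.
- exact: polyfun_mul IHf IHh.
Qed.

Lemma polyfun_univ f : polyfun (eq id) f ->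
  exists p : {poly R}, forall t, f t = p.[t].
Proof.
elim=> {f} [f <-|c|f h _ [p fE] _ [q hE]|f h _ [p fE] _ [q hE]].
- by exists 'X => t; rewrite hornerX.
- by exists c%:P => t; rewrite hornerC.
- by exists (p + q) => t; rewrite hornerD fE hE.
- by exists (p * q) => t; rewrite hornerM fE hE.
Qed.

Lemma poly_nat_roots (p : {poly R}) :
  (forall N, exists2 k, (N <= k)%N & root p k%:R) -> p = 0.
Proof.
move=> Hp; apply/eqP/negPn/negP => p0.
(* The bound [N] on the roots found so far ensures that a root taken beyond it is new. *)
have key : forall k, exists s : seq R,
    [/\ size s = k, uniq s, all (root p) s &
      exists N, forall x, x \in s -> exists2 q, (q < N)%N & x = q%:R].
  elim=> [|k [s [ss us rs [N HN]]]]; first by exists nil; split => //; exists 0%N.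
  have [q Nq rq] := Hp N; exists (q%:R :: s); split => /=.
  - by rewrite ss.
  - rewrite us andbT; apply/negP => /HN [r rN] /eqP.
    by rewrite eqr_nat => /eqP qr; move: rN; rewrite -qr ltnNge Nq.
  - by rewrite rq.
  - exists q.+1 => x; rewrite inE => /orP[/eqP ->|/HN [r rN ->]]; first by exists q.
    by exists r => //; apply: leq_trans rN (leqW Nq).
have [s [ss us rs _]] := key (size p).
by have := max_poly_roots p0 rs us; rewrite ss ltnn.
Qed.

(** Principal open sets suffice: a product of polynomials handles intersections. *)
Definition zopen X (C : (X -> R) -> Prop) (U : X -> Prop) :=
  exists2 f, polyfun C f & forall x, U x <-> f x <> 0.

Lemma zopenI X (C : (X -> R) -> Prop) U V :
  zopen C U -> zopen C V -> zopen C (fun x => U x /\ V x).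
Proof.
move=> [f Pf Uf] [g Pg Vg]; exists (fun x => f x * g x).
  exact: polyfun_mul.
move=> x; rewrite Uf Vg; split=> [[/eqP f0 /eqP g0]|/eqP].
  by apply/eqP; rewrite mulf_neq0.
by rewrite mulf_eq0 negb_or => /andP[/eqP ? /eqP ?].
Qed.

Lemma zopen_comp X Y (C : (X -> R) -> Prop) (D : (Y -> R) -> Prop)
    (g : Y -> X) U :
  (forall h, C h -> polyfun D (h \o g)) -> zopen C U -> zopen D (U \o g).
Proof.
move=> gP [f Pf Uf]; exists (f \o g); first exact: polyfun_comp Pf.
by move=> x; apply: Uf.
Qed.

(** A polynomial vanishing at arbitrarily large naturals is zero. Having all large naturals in [U]
    lets two open conditions be met at once. *)
Lemma zopen_univ (U : R -> Prop) a : zopen (eq id) U -> U a ->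
  exists N, forall k, (N <= k)%N -> U k%:R.
Proof.
move=> [f /polyfun_univ [p fp] Uf] /Uf; rewrite fp => pa.
apply: contrapT => noN; apply: pa; rewrite (_ : p = 0) ?horner0 //.
apply: poly_nat_roots => N; apply: contrapT => noq; apply: noN; exists N => k Nk.
apply/Uf; rewrite fp => pk0; apply: noq; exists k => //; exact/eqP.
Qed.

Lemma zopen_univ2 (U V : R -> Prop) a b :
  zopen (eq id) U -> zopen (eq id) V -> U a -> V b -> exists t, U t /\ V t.
Proof.
move=> oU oV /(zopen_univ oU) [N HN] /(zopen_univ oV) [M HM].
by exists (maxn N M)%:R; split; [apply: HN|apply: HM]; rewrite ?leq_maxl ?leq_maxr.
Qed.

Definition polyvec X (C : (X -> R) -> Prop) d (F : X -> 'rV[R]_d) :=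
  forall k, polyfun C (fun x => F x ord0 k).

Lemma polyfun_dot X (C : (X -> R) -> Prop) d (F G : X -> 'rV[R]_d) :
  polyvec C F -> polyvec C G -> polyfun C (fun x => dot (F x) (G x)).
Proof. by move=> PF PG; apply: polyfun_sum => k _; apply: polyfun_mul. Qed.

Lemma polyvec_cst X (C : (X -> R) -> Prop) d (u : 'rV[R]_d) :
  polyvec C (fun=> u).
Proof. by move=> k; apply: polyfun_cst. Qed.

Lemma polyvecD X (C : (X -> R) -> Prop) d (F G : X -> 'rV[R]_d) :
  polyvec C F -> polyvec C G -> polyvec C (fun x => F x + G x).
Proof.
by move=> PF PG k; apply: eq_polyfun (polyfun_add (PF k) (PG k)) => x; rewrite mxE.
Qed.

Lemma polyvecZ X (C : (X -> R) -> Prop) d f (F : X -> 'rV[R]_d) :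
  polyfun C f -> polyvec C F -> polyvec C (fun x => f x *: F x).
Proof.
by move=> Pf PF k; apply: eq_polyfun (polyfun_mul Pf (PF k)) => x; rewrite mxE.
Qed.

Lemma polyvecB X (C : (X -> R) -> Prop) d (F G : X -> 'rV[R]_d) :
  polyvec C F -> polyvec C G -> polyvec C (fun x => F x - G x).
Proof.
move=> PF PG k; apply: eq_polyfun (polyfun_add (PF k) (polyfun_opp (PG k))) => x.
by rewrite !mxE.
Qed.

Lemma polyvec_sum X (C : (X -> R) -> Prop) d I (r : seq I) (P : pred I)
    (F : I -> X -> 'rV[R]_d) :
  (forall i, P i -> polyvec C (F i)) ->
  polyvec C (fun x => \sum_(i <- r | P i) F i x).
Proof.
move=> PF k; apply: (@eq_polyfun _ _ (fun x => \sum_(i <- r | P i) F i x ord0 k)).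
  by move=> x; rewrite summxE.
by apply: polyfun_sum => i Pi; apply: PF.
Qed.

Definition coord_fun n d (f : ('I_n -> 'rV[R]_d) -> R) : Prop :=
  exists i k, f = fun x => x i ord0 k.

Lemma coord_polyvec n d i : polyvec (@coord_fun n d) (fun x => x i).
Proof. by move=> k; apply: polyfun_gen; exists i, k. Qed.

Lemma coord_comp Y (D : (Y -> R) -> Prop) n d (g : Y -> 'I_n -> 'rV[R]_d) :
  (forall i, polyvec D (fun y => g y i)) ->
  forall h, @coord_fun n d h -> polyfun D (h \o g).
Proof. by move=> Pg h [i [k ->]]; exact: Pg. Qed.

Lemma zopen_line n d (U : ('I_n -> 'rV[R]_d) -> Prop) x y :
  zopen (@coord_fun n d) U ->
  zopen (eq id) (fun t => U (fun i => x i + t *: y i)).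
Proof.
apply: (@zopen_comp _ _ _ _ (fun t i => x i + t *: y i)).
apply: coord_comp => i; apply: polyvecD; first exact: polyvec_cst.
by apply: polyvecZ; [exact: polyfun_gen|exact: polyvec_cst].
Qed.

End PolynomialFunctions.

(** * The Euclidean scalar product *)

Section Dot.
Variables (R : realType) (d : nat).
Implicit Types u v w : 'rV[R]_d.

Lemma dotC u v : dot u v = dot v u.
Proof. by apply: eq_bigr => k _; rewrite mulrC. Qed.

Lemma dotDl u v w : dot (u + v) w = dot u w + dot v w.
Proof.
by rewrite /dot -big_split; apply: eq_bigr => k _; rewrite mxE mulrDl.
Qed.

Lemma dotZl a u w : dot (a *: u) w = a * dot u w.
Proof.
by rewrite /dot big_distrr; apply: eq_bigr => k _; rewrite mxE /= mulrA.
Qed.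

Lemma dotZr a u w : dot u (a *: w) = a * dot u w.
Proof. by rewrite dotC dotZl dotC. Qed.

Lemma dotBl u v w : dot (u - v) w = dot u w - dot v w.
Proof. by rewrite -scaleN1r dotDl dotZl mulN1r. Qed.

Lemma dotDr u v w : dot w (u + v) = dot w u + dot w v.
Proof. by rewrite dotC dotDl !(dotC w). Qed.

Lemma dotBr u v w : dot w (u - v) = dot w u - dot w v.
Proof. by rewrite dotC dotBl !(dotC w). Qed.

Lemma dot0l w : dot 0 w = 0.
Proof. by rewrite -(scale0r (0 : 'rV_d)) dotZl mul0r. Qed.

Lemma dot_suml I (r : seq I) (P : pred I) (F : I -> 'rV[R]_d) w :
  dot (\sum_(i <- r | P i) F i) w = \sum_(i <- r | P i) dot (F i) w.
Proof.
exact: (big_morph (fun u => dot u w) (fun u v => dotDl u v w) (dot0l w)).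
Qed.

Lemma dot_ge0 u : 0 <= dot u u.
Proof. by apply: sumr_ge0 => k _; rewrite -expr2 sqr_ge0. Qed.

Lemma dot_eq0 u : (dot u u == 0) = (u == 0).
Proof.
apply/eqP/eqP => [|->]; last exact: dot0l.
move=> /eqP; rewrite psumr_eq0; last by move=> k _; rewrite -expr2 sqr_ge0.
move=> /allP u0; apply/rowP => k; rewrite mxE.
by have := u0 k (mem_index_enum _); rewrite /= -expr2 sqrf_eq0 => /eqP.
Qed.

Lemma dot_mulmx u v : dot u v = (u *m v^T) ord0 ord0.
Proof. by rewrite mxE; apply: eq_bigr => k _; rewrite mxE. Qed.

End Dot.

(** * Independence through Gram matrices *)

Section Independence.
Variables (R : realType) (n d : nat).
Implicit Types (x : 'I_n -> 'rV[R]_d) (A B : {set 'I_n}) (y z : 'rV[R]_d).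

(** Coefficients on all of ['I_n], supported in [A], keep one index type for every subset. *)
Definition indep x A := forall c : 'I_n -> R,
  (forall i, i \notin A -> c i = 0) -> \sum_i c i *: x i = 0 ->
  forall i, c i = 0.

(* Padding the Gram matrix with the identity keeps its size independent of A. *)
Definition gram x A : 'M[R]_n := \matrix_(i, j)
  if (i \in A) && (j \in A) then dot (x i) (x j) else (i == j)%:R.

(** A row killed by the padded Gram matrix vanishes off [A], and the combination it defines is
    orthogonal to each [x j] with [j] in [A], hence to itself; by positive definiteness it is
    zero. *)
Lemma indep_gram x A : indep x A <-> \det (gram x A) <> 0.
Proof.
split=> [xA /eqP /det0P [v v0 vG]|G0 c cA cx i].
- have vA j : j \notin A -> v ord0 j = 0.
    move=> jA; have /rowP/(_ j) := vG; rewrite !mxE (bigD1 j) //= !mxE (negPf jA).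
    rewrite andbF eqxx mulr1 big1 ?addr0 // => k kj.
    by rewrite !mxE (negPf jA) andbF (negPf kj) mulr0.
  have vx j : j \in A -> dot (\sum_i v ord0 i *: x i) (x j) = 0.
    move=> jA; have /rowP/(_ j) := vG; rewrite !mxE => vj.
    rewrite dot_suml -[RHS]vj; apply: eq_bigr => i _; rewrite dotZl !mxE jA andbT.
    by case: ifPn => // /vA ->; rewrite !mul0r.
  move/eqP: v0; apply; apply/rowP => i; rewrite mxE.
  apply: xA => //; apply/eqP; rewrite -dot_eq0 dot_suml big1 // => k _.
  rewrite dotZl dotC.
  by have [/vx ->|/vA ->] := boolP (k \in A); rewrite ?mulr0 ?mul0r.
- have : (\row_i c i) *m gram x A = 0.
    apply/rowP => j; rewrite !mxE; have [jA|jA] := boolP (j \in A).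
      transitivity (dot (\sum_i c i *: x i) (x j)); last by rewrite cx dot0l.
      rewrite dot_suml; apply: eq_bigr => k _; rewrite !mxE dotZl jA andbT.
      by case: ifPn => // /cA ->; rewrite !mul0r.
    rewrite (bigD1 j) //= big1 ?addr0; first by rewrite !mxE cA ?mul0r.
    by move=> k kj; rewrite !mxE (negPf jA) andbF (negPf kj) mulr0.
  move=> cG; apply: contrapT => ci; apply: G0; apply/eqP/det0P.
  exists (\row_i c i) => //; apply/eqP => /rowP/(_ i); rewrite !mxE; exact: ci.
Qed.

Lemma polyfun_gram A :
  polyfun (@coord_fun R n d) (fun x => \det (gram x A)).
Proof.
apply: polyfun_det => i j; have [ij|ij] := boolP ((i \in A) && (j \in A)).
  apply: (@eq_polyfun _ _ _ (fun x => dot (x i) (x j))).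
    by move=> x; rewrite mxE ij.
  by apply: polyfun_dot; apply: coord_polyvec.
apply: (@eq_polyfun _ _ _ (fun x => (i == j)%:R)); last exact: polyfun_cst.
by move=> x; rewrite mxE (negPf ij).
Qed.

Lemma zopen_indep A : zopen (@coord_fun R n d) (fun x => indep x A).
Proof.
exists (fun x => \det (gram x A)); first exact: polyfun_gram.
by move=> x; exact: indep_gram.
Qed.

Lemma eq_indep x (y : 'I_n -> 'rV[R]_d) A :
  (forall i, i \in A -> x i = y i) -> indep x A -> indep y A.
Proof.
move=> xy xA c cA cy; apply: xA => //; rewrite -[RHS]cy; apply: eq_bigr => i _.
by have [/xy ->|/cA ->] := boolP (i \in A); rewrite ?scale0r.
Qed.

Lemma indep_scale x A (s : 'I_n -> R) :
  (forall i, s i != 0) -> indep x A -> indep (fun i => s i *: x i) A.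
Proof.
move=> s0 xA c cA; under eq_bigr do rewrite scalerA; move=> cx i.
have csA j : j \notin A -> c j * s j = 0 by move=> /cA ->; rewrite mul0r.
have /eqP : c i * s i = 0 := xA (fun i => c i * s i) csA cx i.
by rewrite mulf_eq0 (negPf (s0 i)) orbF => /eqP.
Qed.

(* The orthogonal projection off the span of the [x i], [i \in A], multiplied by
   the Gram determinant so as to be polynomial in [x]. *)
Definition gram_proj x A y : 'rV[R]_d := \det (gram x A) *: y -
  \sum_(i in A) ((\row_j (if j \in A then dot y (x j) else 0)) *m
    \adj (gram x A)) ord0 i *: x i.

(** Cramer's rule: the adjugate solves the normal equations up to the factor [\det (gram x A)],
    whether or not the family is independent. *)
Lemma gram_proj_orth x A y i : i \in A -> dot (gram_proj x A y) (x i) = 0.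
Proof.
move=> iA; rewrite /gram_proj dotBl dotZl dot_suml.
set u := \row_j _; apply/eqP; rewrite subr_eq0; apply/eqP.
set v := u *m _.
have /rowP/(_ i) : v *m gram x A = \det (gram x A) *: u.
  by rewrite -mulmxA mul_adj_mx mul_mx_scalar.
clearbody v; rewrite !mxE iA => <-; rewrite (bigID (mem A)) /=.
rewrite [X in _ + X = _]big1 ?addr0.
  by apply: eq_bigr => j jA; rewrite dotZl !mxE jA iA.
move=> j jA; rewrite !mxE (negPf jA) /= (_ : (j == i) = false) ?mulr0 //.
by apply: contraNF jA => /eqP ->.
Qed.

Lemma gram_proj_span x A y : exists2 c : 'I_n -> R,
  forall i, i \notin A -> c i = 0 &
  gram_proj x A y = \det (gram x A) *: y - \sum_i c i *: x i.
Proof.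
rewrite /gram_proj; set v := _ *m \adj _.
exists (fun i => if i \in A then v ord0 i else 0) => [i /negPf -> //|].
congr (_ - _); rewrite big_mkcond /=; apply: eq_bigr => i _.
by case: ifP; rewrite ?scale0r.
Qed.

Lemma gram_proj_id x A y :
  (forall i, i \in A -> dot y (x i) = 0) -> gram_proj x A y = \det (gram x A) *: y.
Proof.
move=> yA; rewrite /gram_proj (_ : \row_j _ = 0); last first.
  by apply/rowP => j; rewrite !mxE; case: ifP => // /yA.
by rewrite mul0mx big1 ?subr0 // => i _; rewrite mxE scale0r.
Qed.

Lemma polyvec_gram_proj A y : polyvec (@coord_fun R n d) (fun x => gram_proj x A y).
Proof.
apply: polyvecB; first by apply: polyvecZ; [exact: polyfun_gram|exact: polyvec_cst].
apply: polyvec_sum => i _; apply: polyvecZ; last exact: coord_polyvec.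
apply: (@eq_polyfun _ _ _ (fun x => \sum_j (if j \in A then dot y (x j) else 0) *
  cofactor (gram x A) i j)).
  by move=> x; rewrite mxE; apply: eq_bigr => j _; rewrite !mxE.
apply: polyfun_sum => j _; apply: polyfun_mul.
  case: (j \in A); last exact: polyfun_cst.
  by apply: polyfun_dot; [exact: polyvec_cst|exact: coord_polyvec].
rewrite /cofactor; apply: polyfun_mul; first exact: polyfun_cst.
apply: polyfun_det => k l.
apply: (@eq_polyfun _ _ _ (fun x => gram x A (lift i k) (lift j l))).
  by move=> x; rewrite !mxE.
have [kl|kl] := boolP ((lift i k \in A) && (lift j l \in A)).
  apply: (@eq_polyfun _ _ _ (fun x => dot (x (lift i k)) (x (lift j l)))).
    by move=> x; rewrite mxE kl.
  by apply: polyfun_dot; apply: coord_polyvec.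
apply: (@eq_polyfun _ _ _ (fun x => (lift i k == lift j l)%:R));
  last exact: polyfun_cst.
by move=> x; rewrite mxE (negPf kl).
Qed.

(** The factor [a] is the ratio of the two Gram determinants: the difference of the two sides then
    lies in the span of [A] and is orthogonal to it. *)
Lemma gram_proj_scale x A y (s : 'I_n -> R) : (forall i, s i != 0) -> indep x A ->
  exists2 a, a != 0 & gram_proj (fun i => s i *: x i) A y = a *: gram_proj x A y.
Proof.
move=> s0 xA; have sxA := indep_scale s0 xA.
have /eqP D0 := (indep_gram _ _).1 xA; have /eqP E0 := (indep_gram _ _).1 sxA.
exists (\det (gram (fun i => s i *: x i) A) / \det (gram x A)).
  by rewrite mulf_neq0 ?invr_eq0.
have [b bA bE] := gram_proj_span (fun i => s i *: x i) A y.
have [c cA cE] := gram_proj_span x A y.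
set D := \det (gram x A) in D0 cE *; set E := \det _ in E0 bE *.
set p := gram_proj _ _ _ in bE *; set q := gram_proj _ _ _ in cE *.
have pqE : p - (E / D) *: q = \sum_i (E / D * c i - b i * s i) *: x i.
  rewrite bE cE scalerBr scalerA divfK // opprB addrC addrA subrK.
  rewrite scaler_sumr -sumrB; apply: eq_bigr => i _.
  by rewrite scalerBl !scalerA.
have : dot (p - (E / D) *: q) (p - (E / D) *: q) = 0.
  rewrite {2}pqE dotC dot_suml big1 // => i _; rewrite dotZl.
  have [iA|iA] := boolP (i \in A); last by rewrite cA // bA // !(mulr0, mul0r, subr0).
  rewrite dotC dotBl dotZl (gram_proj_orth x y iA) mulr0 subr0.
  have := @gram_proj_orth (fun i => s i *: x i) A y i iA.
  rewrite dotZr -/p => /eqP; rewrite mulf_eq0 (negPf (s0 i)) /= => /eqP ->.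
  by rewrite mulr0.
by move/eqP; rewrite dot_eq0 subr_eq0 => /eqP.
Qed.

Lemma orth_exists x A : (#|A| < d)%N ->
  exists2 z, z != 0 & forall i, i \in A -> dot z (x i) = 0.
Proof.
move=> Ad; pose B : 'M[R]_(d, #|A|) := \matrix_(k, i) x (enum_val i) ord0 k.
have /rowV0Pn [z /sub_kermxP zB z0] : kermx B != 0.
  rewrite -mxrank_eq0 mxrank_ker subn_eq0 -ltnNge.
  by apply: leq_ltn_trans Ad; exact: rank_leq_col.
exists z => // i iA; have /rowP/(_ (enum_rank_in iA i)) := zB.
rewrite !mxE => zi; rewrite -[RHS]zi; apply: eq_bigr => k _.
by rewrite !mxE enum_rankK_in.
Qed.

Lemma indep_card_orth x A z : indep x A -> #|A| = d ->
  (forall i, i \in A -> dot z (x i) = 0) -> z = 0.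
Proof.
move=> xA Ad zA; pose B : 'M[R]_(#|A|, d) := \matrix_(i, k) x (enum_val i) ord0 k.
have rB : row_free B.
  apply/row_freeP; apply: contrapT => nB.
  have /rowV0Pn [v /sub_kermxP vB /eqP v0] : kermx B != 0.
    by apply/negP; rewrite kermx_eq0 => /row_freeP.
  apply: v0; apply/rowP => k; rewrite mxE.
  (* Transports the row [v] to coefficients on ['I_n]; the sum has at most one term. *)
  pose c i := \sum_(k < #|A| | enum_val k == i) v ord0 k.
  have <- : c (enum_val k) = v ord0 k.
    rewrite /c (bigD1 k) //= big1 ?addr0 // => l /andP[/eqP/enum_val_inj -> //].
    by rewrite eqxx.
  apply: xA => [i iA|].
    by rewrite /c big1 // => l /eqP li; rewrite -li enum_valP in iA.
  rewrite -[RHS]vB mulmx_sum_row.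
  under eq_bigr do rewrite /c scaler_suml.
  rewrite (exchange_big_dep xpredT) //=; apply: eq_bigr => l _.
  rewrite (big_pred1 (enum_val l)) => [|j]; last by rewrite /= eq_sym.
  by congr (_ *: _); apply/rowP => j; rewrite !mxE.
have : B *m z^T = 0.
  apply/colP => i; rewrite !mxE; have := zA _ (enum_valP i); rewrite dotC => zi.
  by rewrite -[RHS]zi; apply: eq_bigr => k _; rewrite !mxE.
have : row_full B by rewrite /row_full (eqP rB) Ad.
case/row_fullP => C CB Bz; apply: trmx_inj.
by rewrite -[z^T]mul1mx -CB -mulmxA Bz mulmx0 trmx0.
Qed.

End Independence.

(** * Existence of independent representations *)

Section Representations.
Variables (R : realType) (n : nat) (W : 'I_n -> {set 'I_n}).
Hypothesis W_lt : forall i j, i \in W j -> (i < j)%N.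

Definition representation d m (x : 'I_n -> 'rV[R]_d) := forall j : 'I_n,
  (j < m)%N -> indep x (W j) /\ forall i, i \in W j -> dot (x j) (x i) = 0.

Definition depends d m (U : ('I_n -> 'rV[R]_d) -> Prop) :=
  forall x y, (forall i : 'I_n, (i < m)%N -> x i = y i) -> U x -> U y.

(** The random vectors have unit length while those of a representation have any length, so only
    scale-invariant conditions are transferred from one to the other. *)
Definition rescalable d (U : ('I_n -> 'rV[R]_d) -> Prop) :=
  forall x (s : 'I_n -> R), (forall i, s i != 0) -> U x ->
    U (fun i => s i *: x i).

Definition upd d (x : 'I_n -> 'rV[R]_d) (m : 'I_n) y : 'I_n -> 'rV[R]_d :=
  fun i => if i == m then y else x i.

(** Trades a condition on the first m + 1 vectors for one on the first m: position [m] receives the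
    projection of a fixed vector [y], which is polynomial in the other vectors. Inductions on the
    number of positions rest on this. *)
Definition extends d (U : ('I_n -> 'rV[R]_d) -> Prop) m y x :=
  indep x (W m) /\ U (upd x m (gram_proj x (W m) y)).

Lemma representation_depends d m : depends m (@representation d m).
Proof.
move=> x y xy xm j jm; have [xj xo] := xm j jm; split.
  by apply: eq_indep xj => i /W_lt ij; apply: xy; apply: ltn_trans jm.
by move=> i ij; rewrite -!xy ?xo //; apply: ltn_trans jm; apply: W_lt.
Qed.

Lemma representation_le d m k (x : 'I_n -> 'rV[R]_d) :
  (k <= m)%N -> representation m x -> representation k x.
Proof. by move=> km xm j jk; apply: xm; apply: leq_trans km. Qed.

Lemma indep_depends d m (A : {set 'I_n}) : (forall i, i \in A -> (i < m)%N) ->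
  depends m (fun x : 'I_n -> 'rV[R]_d => indep x A).
Proof. by move=> Am x y xy; apply: eq_indep => i /Am; apply: xy. Qed.

Lemma upd_lt d (x : 'I_n -> 'rV[R]_d) (m i : 'I_n) y : (i < m)%N -> upd x m y i = x i.
Proof. by rewrite /upd => im; case: eqP im => // ->; rewrite ltnn. Qed.

Lemma upd_same d (x : 'I_n -> 'rV[R]_d) m y : upd x m y m = y.
Proof. by rewrite /upd eqxx. Qed.

Lemma upd_id d (x : 'I_n -> 'rV[R]_d) m : upd x m (x m) = x.
Proof. by apply/funext => i; rewrite /upd; case: eqP => // ->. Qed.

Lemma representationS d (m : 'I_n) (x : 'I_n -> 'rV[R]_d) y :
  representation m x -> indep x (W m) ->
  (forall i, i \in W m -> dot y (x i) = 0) -> representation m.+1 (upd x m y).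
Proof.
move=> xm xW yW j; rewrite ltnS leq_eqVlt => /orP[/eqP/val_inj ->|jm].
  split=> [|i iW]; last by rewrite upd_same upd_lt ?yW // W_lt.
  by apply: eq_indep xW => i /W_lt im; rewrite upd_lt.
by apply: (representation_depends (x := x)) jm => // i im; rewrite upd_lt.
Qed.

Lemma eq_gram_proj d (x y : 'I_n -> 'rV[R]_d) (A : {set 'I_n}) z :
  (forall i, i \in A -> x i = y i) -> gram_proj x A z = gram_proj y A z.
Proof.
move=> xy; rewrite /gram_proj.
have -> : gram x A = gram y A.
  apply/matrixP => i j; rewrite !mxE.
  by case: ifPn => // /andP[/xy -> /xy ->].
congr (_ - _); apply: eq_bigr => i iA; rewrite xy //.
congr ((_ *m _) _ _ *: _); apply/rowP => j; rewrite !mxE.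
by case: ifP => // /xy ->.
Qed.

Lemma zopen_upd d (U : ('I_n -> 'rV[R]_d) -> Prop) X (C : (X -> R) -> Prop) g m p :
  (forall i, polyvec C (fun t : X => g t i)) -> polyvec C p ->
  zopen (@coord_fun R n d) U -> zopen C (fun t => U (upd (g t) m (p t))).
Proof.
move=> Pg Pp; apply: (@zopen_comp _ _ _ _ _ (fun t => upd (g t) m (p t))).
by apply: coord_comp => i; rewrite /upd; case: eqP.
Qed.

Lemma zopen_extends d (U : ('I_n -> 'rV[R]_d) -> Prop) m y :
  zopen (@coord_fun R n d) U -> zopen (@coord_fun R n d) (extends U m y).
Proof.
move=> oU; apply: zopenI; first exact: zopen_indep.
by apply: zopen_upd => //; [exact: coord_polyvec|exact: polyvec_gram_proj].
Qed.

Lemma extends_depends d (U : ('I_n -> 'rV[R]_d) -> Prop) (m : 'I_n) y :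
  depends m.+1 U -> depends m (extends U m y).
Proof.
move=> dU u v uv [uW Uu]; split.
  by apply: eq_indep uW => i /W_lt im; exact: uv.
rewrite -(@eq_gram_proj _ u v); last by move=> i /W_lt im; exact: uv.
apply: dU Uu => i; rewrite ltnS leq_eqVlt => /orP[/eqP/val_inj ->|im].
  by rewrite !upd_same.
by rewrite !upd_lt // uv.
Qed.

Lemma extends_rescalable d (U : ('I_n -> 'rV[R]_d) -> Prop) m y :
  rescalable U -> rescalable (extends U m y).
Proof.
move=> sU x s s0 [xW Ux]; split; first exact: indep_scale.
have [a a0 ->] := gram_proj_scale y s0 xW.
rewrite (_ : upd _ _ _ = fun i => (if i == m then a else s i) *:
                              upd x m (gram_proj x (W m) y) i).
  by apply: sU => // i; case: ifP.
by apply/funext => i; rewrite /upd; case: eqP.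
Qed.

(** As [x m] is already orthogonal to [W m], projecting only multiplies by the Gram determinant; the
    inverse factor makes the projection return [x m] itself. *)
Lemma extends_self d (U : ('I_n -> 'rV[R]_d) -> Prop) (m : 'I_n) x :
  representation m.+1 x -> U x ->
  extends U m ((\det (gram x (W m)))^-1 *: x m) x.
Proof.
move=> xm Ux; have [xW xo] := xm m (ltnSn m); split => //.
rewrite gram_proj_id; last by move=> i /xo; rewrite dotZl => ->; rewrite mulr0.
by rewrite scalerA divff ?scale1r ?upd_id //; apply/eqP/indep_gram.
Qed.

(* Irreducibility of the variety of representations. *)
Lemma representation_zopenI d m U V : (m <= n)%N ->
  zopen (@coord_fun R n d) U -> zopen (@coord_fun R n d) V ->
  (exists2 x, representation m x & U x) ->
  (exists2 x, representation m x & V x) ->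
  exists x, [/\ representation m x, U x & V x].
Proof.
elim: m U V => [|k IH] U V km oU oV [x xk Ux] [y yk Vy].
  (* With no position constrained, [x] and [y] are joined by a line of families. *)
  have [||t [Ut Vt]] := zopen_univ2 (a := 0) (b := 1)
    (zopen_line x (fun i => y i - x i) oU) (zopen_line x (fun i => y i - x i) oV).
  - by under eq_fun do rewrite scale0r addr0.
  - by under eq_fun do rewrite scale1r addrC subrK.
  by exists (fun i => x i + t *: (y i - x i)).
pose m := Ordinal km.
have [||z [zk [zW Uz] [_ Vz]]] := IH _ _ (ltnW km)
  (zopen_extends m ((\det (gram x (W m)))^-1 *: x m) oU)
  (zopen_extends m ((\det (gram y (W m)))^-1 *: y m) oV).
- by exists x; [exact: representation_le xk|exact: extends_self].
- by exists y; [exact: representation_le yk|exact: extends_self].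
(* Over the common [z], both [p] and [q] are orthogonal to [W m], and so is the whole line through
   them; [U] holds at 0 and [V] at 1. *)
set p := gram_proj z _ _ in Uz; set q := gram_proj z _ _ in Vz.
have pol : polyvec (eq id) (fun t => p + t *: (q - p)).
  apply: polyvecD; first exact: polyvec_cst.
  by apply: polyvecZ; [exact: polyfun_gen|exact: polyvec_cst].
have zline (V' : ('I_n -> 'rV[R]_d) -> Prop) : zopen (@coord_fun R n d) V' ->
    zopen (eq id) (fun t => V' (upd z m (p + t *: (q - p)))).
  by move=> oV'; apply: (@zopen_upd _ _ _ _ (fun=> z) m _ _ pol oV') => i;
    exact: polyvec_cst.
have [||t [Ut Vt]] := zopen_univ2 (a := 0) (b := 1) (zline _ oU) (zline _ oV).
- by rewrite scale0r addr0.
- by rewrite scale1r addrC subrK.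
exists (upd z m (p + t *: (q - p))); split => //.
apply: (@representationS _ m) => // i iW.
by rewrite dotDl dotZl dotBl !gram_proj_orth // subrr mulr0 addr0.
Qed.

Hypothesis W_greedy : forall i j : 'I_n, (i <= j)%N ->
  (#|W i| <= #|[set h in W j | (h < i)%N]%SET|)%N.

Definition admissible m (A : {set 'I_n}) :=
  (forall i, i \in A -> (i < m)%N) /\
  forall i : 'I_n, (i < m)%N -> (#|W i| <= #|[set h in A | (h < i)%N]%SET|)%N.

Lemma admissible_W (m : 'I_n) : admissible m (W m).
Proof. by split=> [i /W_lt|i /ltnW im] //; exact: W_greedy. Qed.

Lemma admissible_le m k (A : {set 'I_n}) :
  (k <= m)%N -> (forall i, i \in A -> (i < k)%N) ->
  admissible m A -> admissible k A.
Proof. by move=> km Ak [_ Am]; split => // i ik; apply: Am; apply: leq_trans km. Qed.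

(** By admissibility [A] has at least [#|W i|] elements below [i], which is already all of them. *)
Lemma admissible_prefix m (A : {set 'I_n}) (i : 'I_n) :
  admissible m A -> (i < m)%N ->
  (#|A| <= #|W i|)%N -> forall h, h \in A -> (h < i)%N.
Proof.
move=> [_ Am] im AWi h hA.
have sub : [set h in A | (h < i)%N]%SET \subset A.
  by apply/fintype.subsetP => k; rewrite inE => /andP[].
have /eqP E : [set h in A | (h < i)%N]%SET == A.
  by rewrite eqEcard sub (leq_trans AWi) // Am.
by move: hA; rewrite -E inE => /andP[].
Qed.

(** The rows of the Gram matrix of [A] against [B], padded with zeros to length [n] so that
    [zopen_indep] applies. Only scalar products occur, so the ambient dimension may change. *)
Definition cross_indep d (A B : {set 'I_n}) (x : 'I_n -> 'rV[R]_d) :=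
  indep (fun i => \row_j (if j \in B then dot (x i) (x j) else 0)) A.

Lemma zopen_cross_indep d A B : zopen (@coord_fun R n d) (cross_indep A B).
Proof.
apply: (@zopen_comp _ _ _ _ _ (fun (x : 'I_n -> 'rV[R]_d) i =>
  \row_j (if j \in B then dot (x i) (x j) else 0)) _ _ (zopen_indep _ _ A)).
apply: coord_comp => i k.
apply: (@eq_polyfun _ _ _ (fun x => if k \in B then dot (x i) (x k) else 0)).
  by move=> x; rewrite mxE.
by case: (k \in B); [apply: polyfun_dot; apply: coord_polyvec|apply: polyfun_cst].
Qed.

Lemma cross_indepE d (A B : {set 'I_n}) (x : 'I_n -> 'rV[R]_d) (c : 'I_n -> R) :
  cross_indep A B x -> (forall i, i \notin A -> c i = 0) ->
  (forall j, j \in B -> dot (\sum_i c i *: x i) (x j) = 0) -> forall i, c i = 0.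
Proof.
move=> xAB cA cB; apply: xAB => //; apply/rowP => j; rewrite summxE mxE.
have [jB|/negPf jB] := boolP (j \in B).
  rewrite -[RHS](cB j jB) dot_suml; apply: eq_bigr => i _.
  by rewrite dotZl !mxE jB.
by apply: big1 => i _; rewrite !mxE jB mulr0.
Qed.

Lemma cross_indep_dot d d' A B (x : 'I_n -> 'rV[R]_d) (y : 'I_n -> 'rV[R]_d') :
  (forall i j, dot (x i) (x j) = dot (y i) (y j)) ->
  cross_indep A B x -> cross_indep A B y.
Proof.
move=> xy; rewrite /cross_indep.
suff -> : (fun i => \row_j (if j \in B then dot (x i) (x j) else 0)) =
          (fun i => \row_j (if j \in B then dot (y i) (y j) else 0)) by [].
by apply/funext => i; apply/rowP => j; rewrite !mxE xy.
Qed.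

Lemma representation_dot d d' m (x : 'I_n -> 'rV[R]_d) (y : 'I_n -> 'rV[R]_d') :
  (forall i j, dot (x i) (x j) = dot (y i) (y j)) ->
  representation m x -> representation m y.
Proof.
move=> xy xm j /xm [xj xo]; split; last by move=> i /xo; rewrite xy.
apply/indep_gram; rewrite (_ : gram y (W j) = gram x (W j)); first exact/indep_gram.
by apply/matrixP => k l; rewrite !mxE xy.
Qed.

(** Zero coordinates are appended. *)
Lemma isometric_embedding d' d (x : 'I_n -> 'rV[R]_d') : (d' <= d)%N ->
  exists y : 'I_n -> 'rV[R]_d, forall i j, dot (x i) (x j) = dot (y i) (y j).
Proof.
move=> dd; exists (fun i => x i *m pid_mx d') => i j.
rewrite !dot_mulmx trmx_mul mulmxA -(mulmxA (x i)) tr_pid_mx mul_pid_mx.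
by rewrite minnn (minn_idPr dd) pid_mx_1 mulmx1.
Qed.

Definition generic_indep m := forall d A, admissible m A -> (#|A| <= d)%N ->
  (forall i : 'I_n, (i < m)%N -> (#|W i| < d)%N) ->
  exists2 x : 'I_n -> 'rV[R]_d, representation m x & indep x A.

(** At each new position [j], irreducibility makes [U] compatible with independence of [W j], after
    which a vector can be added without affecting [U]. *)
Lemma representation_extend d k m U : (k <= m <= n)%N ->
  (forall j, (j < m)%N -> generic_indep j) ->
  (forall i : 'I_n, (i < m)%N -> (#|W i| < d)%N) ->
  zopen (@coord_fun R n d) U -> depends k U ->
  (exists2 x, representation k x & U x) -> exists2 x, representation m x & U x.
Proof.
move=> /andP[km mn] gen Wd oU dU xk.
elim: m km mn gen Wd => [|m IH]; first by rewrite leqn0 => /eqP k0; subst k.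
rewrite leq_eqVlt => /orP[/eqP km|]; first by subst k.
rewrite ltnS => km mn gen Wd.
have [||x xm Ux] := IH km (ltnW mn); [by move=> j jm; apply: gen; apply: ltnW..|
  by move=> j jm; apply: Wd; apply: ltnW|].
pose j := Ordinal mn.
have [||y ym yW] := gen m (ltnSn m) d (W j) (admissible_W j).
- by apply: ltnW; apply: Wd.
- by move=> i im; apply: Wd; apply: ltnW.
have [||z [zm Uz zW]] := representation_zopenI (ltnW mn) oU (zopen_indep R d (W j)).
- by exists x.
- by exists y.
(* Zero is allowed at position [j]: only orthogonality to [W j] and independence of [W j] are
   required there. *)
exists (upd z j 0); first by apply: (@representationS _ j) => // i _; rewrite dot0l.
by apply: dU Uz => i ik; rewrite upd_lt //; apply: leq_trans km.
Qed.

(** In dimension [#|B|] an independent [B] is a basis, so cross independence reduces to independence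
    of [A] and of [B]. That dimension is too small when some [W i] has at least [#|B|] elements;
    then [A] and [B] lie below [i], and the induction is on [m]. *)
Lemma generic_cross_indep m d A B : (m <= n)%N ->
  (forall k, (k <= m)%N -> generic_indep k) ->
  (forall i : 'I_n, (i < m)%N -> (#|W i| < d)%N) ->
  admissible m A -> admissible m B -> (#|A| <= #|B| < d)%N ->
  exists2 x : 'I_n -> 'rV[R]_d, representation m x & cross_indep A B x.
Proof.
have [k] := ubnP m; elim: k m => // k IH m; rewrite ltnS => mk mn gen Wd.
move=> aA aB /andP[AB Bd].
have [WB|/existsNP [i /not_implyP [im /negP]]] :=
    pselect (forall i : 'I_n, (i < m)%N -> (#|W i| < #|B|)%N).
  (* Work in dimension [#|B|], then embed isometrically into dimension [d]. *)
  have [x xm xA] := gen m (leqnn m) #|B| A aA AB WB.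
  have [y ym yB] := gen m (leqnn m) #|B| B aB (leqnn _) WB.
  have [||z [zm zA zB]] := representation_zopenI mn
    (zopen_indep R #|B| A) (zopen_indep R #|B| B).
  - by exists x.
  - by exists y.
  have [t zt] := isometric_embedding z (ltnW Bd).
  exists t; first exact: representation_dot zm.
  apply: (cross_indep_dot zt) => c cA cB; apply: zA => //.
  apply: (indep_card_orth zB) => // j jB.
  have /rowP/(_ j) := cB; rewrite summxE !mxE => cj; rewrite -[RHS]cj dot_suml.
  by apply: eq_bigr => l _; rewrite dotZl !mxE jB.
rewrite -leqNgt => BWi.
have Ai := admissible_prefix aA im (leq_trans AB BWi).
have Bi := admissible_prefix aB im BWi.
have [|||||x xi xAB] := IH i _ _ _ _ (admissible_le (ltnW im) Ai aA)
  (admissible_le (ltnW im) Bi aB) _.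
- exact: leq_trans im mk.
- exact: ltnW.
- by move=> j ji; apply: gen; apply: leq_trans ji (ltnW im).
- by move=> j ji; apply: Wd; apply: ltn_trans im.
- by rewrite AB.
(* The representation found below [i] is prolonged up to [m] in the original dimension [d]. *)
apply: (@representation_extend d i m) => //; first by rewrite (ltnW im).
- by move=> j /ltnW; apply: gen.
- exact: zopen_cross_indep.
- move=> u v uv; rewrite /cross_indep; apply: eq_indep => h hA.
  apply/rowP => j; rewrite !mxE; case: ifP => // jB.
  by rewrite (uv h (Ai h hA)) (uv j (Bi j jB)).
- by exists x.
Qed.

Lemma representation_indep m : (m <= n)%N -> generic_indep m.
Proof.
have [k] := ubnP m; elim: k m => // k IH [_ _ d A [A0 _] _ _|m].
  exists (fun=> 0) => // c cA _ i; apply: cA; by apply/negP => /A0.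
rewrite ltnS => mk mn d A aA Ad Wd; pose j := Ordinal mn.
have gen i : (i <= m)%N -> generic_indep i.
  by move=> im; apply: IH; [apply: leq_ltn_trans mk|apply: leq_trans (ltnW mn)].
have Wdm (i : 'I_n) : (i < m)%N -> (#|W i| < d)%N.
  by move=> im; apply: Wd; apply: ltnW.
have [x xm xW] := gen m (leqnn m) d (W j) (admissible_W j) (ltnW (Wd j (ltnSn m))) Wdm.
have A_lt i : i \in A :\ j -> (i < m)%N.
  rewrite !inE => /andP[ij /aA.1]; rewrite ltnS leq_eqVlt => /orP[/eqP im|//].
  by move: ij; rewrite -val_eqE /= im eqxx.
have Am : [set h in A | (h < m)%N]%SET = A :\ j.
  apply/setP => i; rewrite [LHS]inE; apply/andP/idP => [[iA im]|iA].
    by rewrite !inE iA andbT; apply: contraTneq im => ->; rewrite /= ltnn.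
  by rewrite A_lt //; move: iA; rewrite !inE => /andP[].
have aA' : admissible m (A :\ j).
  split=> // i im; apply: leq_trans (aA.2 i (leqW im)) _.
  apply: subset_leq_card; apply/fintype.subsetP => h; rewrite !inE.
  move=> /andP[-> hi]; rewrite hi !andbT; apply: contraTneq hi => ->.
  by rewrite -leqNgt ltnW.
have [jA|jA] := boolP (j \in A); last first.
  have AE : A :\ j = A.
    by apply/setP => i; rewrite !inE; case: eqP => // ->; rewrite (negPf jA).
  rewrite AE in aA'.
  have [y ym yA] := gen m (leqnn m) d A aA' Ad Wdm.
  have [||z [zm zW zA]] := representation_zopenI (ltnW mn)
    (zopen_indep R d (W j)) (zopen_indep R d A).
  - by exists x.
  - by exists y.
  exists (upd z j 0); first by apply: (@representationS _ j) => // i _; rewrite dot0l.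
  apply: eq_indep zA => i iA; rewrite upd_lt //; exact: (aA'.1 i iA).
have Ad' : (#|A :\ j| < d)%N by move: Ad; rewrite (cardsD1 j) jA.
have WA : (#|W j| <= #|A :\ j|)%N by rewrite -Am; exact: aA.2.
have [|y ym yWA] := generic_cross_indep (ltnW mn) gen Wdm (admissible_W j) aA'.
  by rewrite WA.
have [y' ym' yA] := gen m (leqnn m) d _ aA' (ltnW Ad') Wdm.
(* Two uses of irreducibility give one representation [t] meeting all three open conditions. *)
have [||z [zm zW zWA]] := representation_zopenI (ltnW mn) (zopen_indep R d (W j))
  (zopen_cross_indep d (W j) (A :\ j)).
- by exists x.
- by exists y.
have [||t [tm [tW tWA] tA]] := representation_zopenI (ltnW mn)
  (zopenI (zopen_indep R d (W j)) (zopen_cross_indep d (W j) (A :\ j)))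
  (zopen_indep R d (A :\ j)).
- by exists z.
- by exists y'.
(* The new vector is the projection to the orthogonal complement of [W j] of a
   vector [u] orthogonal to the rest of [A]. *)
have [u u0 uA] := orth_exists t Ad'.
pose p := gram_proj t (W j) u.
have [c cW pE] := gram_proj_span t (W j) u; rewrite -/p in pE.
(* Otherwise a multiple of [u] is a combination of [W j] orthogonal to [A :\ j]; cross independence
   makes it trivial, although [u] and the Gram determinant are nonzero. *)
have p0 : p != 0.
  apply/eqP => p0; have c0 : forall i, c i = 0.
    apply: (cross_indepE tWA cW) => i iA.
    rewrite (_ : \sum_i _ = \det (gram t (W j)) *: u).
      by rewrite dotZl uA ?mulr0.
    by apply/esym/eqP; rewrite -subr_eq0 -pE p0.
  move: p0; rewrite pE big1 ?subr0 => [/eqP|i _]; last by rewrite c0 scale0r.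
  rewrite scaler_eq0 (negPf u0) orbF => /eqP; exact/indep_gram.
(* Thus [u] separates [p] from the span of [A :\ j], to which it is orthogonal. *)
have pu : dot p u != 0.
  have : dot p p = \det (gram t (W j)) * dot p u.
    rewrite {2}pE dotBr dotZr [X in _ - X]dotC dot_suml big1 ?subr0 // => i _.
    rewrite dotZl dotC; have [iW|/cW ->] := boolP (i \in W j).
      by rewrite gram_proj_orth ?mulr0.
    by rewrite mul0r.
  move=> ppE; apply: contra p0 => /eqP pu.
  by rewrite -dot_eq0 ppE pu mulr0.
exists (upd t j p).
  by apply: (@representationS _ j) => // i iW; exact: gram_proj_orth.
move=> b bA bx.
(* Pairing the relation with [u] leaves only the term at [j]. *)
have bj : b j = 0.
  apply: contrapT => /eqP bj; have : dot (\sum_i b i *: upd t j p i) u = 0.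
    by rewrite bx dot0l.
  rewrite dot_suml (bigD1 j) //= big1 ?addr0 => [/eqP|i ij].
    by rewrite dotZl upd_same mulf_eq0 (negPf bj) (negPf pu).
  rewrite dotZl; have [iA|/bA ->] := boolP (i \in A); last by rewrite mul0r.
  have iAj : i \in A :\ j by rewrite !inE ij.
  by rewrite upd_lt ?A_lt // dotC uA ?mulr0.
apply: tA => [i|].
  by rewrite !inE negb_and negbK => /orP[/eqP -> //|]; exact: bA.
rewrite -[RHS]bx; apply: eq_bigr => i _; rewrite /upd.
by case: eqP => // ->; rewrite bj !scale0r.
Qed.

End Representations.

(** * Null sets of polynomial families and of kernels *)

Section PolynomialMeasurability.
Variable R : realType.

Lemma polyfun_measurable disp (X : measurableType disp) (C : (X -> R) -> Prop) f :
  (forall h, C h -> measurable_fun [set: X] h) -> polyfun C f ->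
  measurable_fun [set: X] f.
Proof.
move=> mC; elim=> {f} [f /mC//|c|f g _ mf _ mg|f g _ mf _ mg].
- exact: measurable_cst.
- exact: measurable_funD.
- exact: measurable_funM.
Qed.

Lemma measurable_coord_rV d (k : 'I_d) :
  measurable_fun [set: 'rV[R]_d] (fun x : 'rV[R]_d => x ord0 k).
Proof.
move=> _ Y mY; rewrite setTI; apply: sub_sigma_algebra => /=.
rewrite -bigcup_seq /=; exists k => /=; first by rewrite mem_index_enum.
by exists Y => //; rewrite setTI.
Qed.

Lemma measurable_polyfun_neq0 disp (X : measurableType disp)
    (C : (X -> R) -> Prop) f :
  (forall h, C h -> measurable_fun [set: X] h) -> polyfun C f ->
  measurable [set x | f x <> 0].
Proof.
move=> mC Pf; have mf := polyfun_measurable mC Pf.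
have := mf measurableT [set~ 0] (measurableC (measurable_set1 0)).
by rewrite setTI.
Qed.

Lemma measurable_zopen disp (X : measurableType disp)
    (C : (X -> R) -> Prop) U :
  (forall h, C h -> measurable_fun [set: X] h) -> zopen C U ->
  measurable [set x | U x].
Proof.
move=> mC [f Pf Uf]; have := measurable_polyfun_neq0 mC Pf.
by congr (measurable _); apply/seteqP; split => x /= /Uf.
Qed.

End PolynomialMeasurability.

(** * Common zeros of a polynomial family of functions *)

Section PolynomialFamilies.
Context disp (X : measurableType disp) (R : realType).
Variable mu : {measure set X -> \bar R}.
Hypothesis mu_fin : (mu setT < +oo)%E.

(** The last hypothesis identifies the intersection with the limit superior, whose measure, [mu]
    being finite, is the limit of the measures of the tail unions, all at least [c]. *)
Lemma measure_bigcap_infinitely_often (A : (set X)^nat) c :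
  (forall k, measurable (A k)) -> (forall k, (c <= mu (A k))%E) ->
  (forall x, (forall N, exists2 k, (N <= k)%N & A k x) -> forall k, A k x) ->
  (c <= mu (\bigcap_k A k))%E.
Proof.
move=> mA cA Aio; have mU n : measurable (\bigcup_(k >= n) A k).
  exact: bigcup_measurable.
have muU : (mu (\bigcup_(k >= 0) A k) < +oo)%E.
  by apply: le_lt_trans mu_fin; apply: le_measure; rewrite ?inE.
have cvgA := lim_sup_set_cvg mu A mA muU.
have -> : \bigcap_k A k = lim_sup_set A.
  apply/seteqP; split=> x Ax.
    by move=> n _; exists n => //=; exact: Ax.
  move=> k _; apply: Aio => N; have [j /= Nj Aj] := Ax N I; by exists j.
apply: cvge_to_ge cvgA _; near=> n.
apply: le_trans (cA n) _; apply: le_measure; rewrite ?inE //.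
by move=> x Anx; exists n => /=.
Unshelve. all: by end_near. Qed.

Variable F : X -> (nat -> R) -> R.
Let updn (s : nat -> R) k t : nat -> R := fun i => if i == k then t else s i.

Let updnC s k l t u : k != l -> updn (updn s k t) l u = updn (updn s l u) k t.
Proof.
move=> kl; apply/funext => i; rewrite /updn.
by have [->|//] := eqVneq i l; rewrite eq_sym (negPf kl).
Qed.

Hypothesis F_meas : forall s, measurable [set x | F x s = 0].
Hypothesis F_poly : forall x s k, polyfun (eq id) (fun t => F x (updn s k t)).

(* The points at which [F] vanishes for all natural values of the first [k]
   parameters: a countable intersection, hence measurable. *)
Let zeros := fix zeros k s : set X := match k with
  | 0 => [set x | F x s = 0]
  | k'.+1 => \bigcap_(r : nat) zeros k' (updn s k' r%:R)
  end.

Let zeros_measurable k s : measurable (zeros k s).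
Proof. by elim: k s => [|k IH] s //=; apply: bigcapT_measurable. Qed.

(** [zeros k] varies only parameters below [k], so changing parameter [j] commutes with it; what
    remains is a polynomial in that parameter with arbitrarily large natural roots. *)
Let zeros_poly k j s x : (k <= j)%N ->
  (forall N, exists2 r, (N <= r)%N & zeros k (updn s j r%:R) x) ->
  forall t, zeros k (updn s j t) x.
Proof.
elim: k j s => [|k IH] j s kj H t /=.
  have [p pE] := polyfun_univ (F_poly x s j); rewrite pE.
  rewrite (@poly_nat_roots _ p) ?horner0 // => N; have [r Nr /= zr] := H N.
  by exists r => //; rewrite /root -pE zr.
have kj' : k != j by rewrite neq_ltn kj.
move=> r _; rewrite updnC 1?eq_sym //; apply: IH; first exact: ltnW.
move=> N; have [q Nq zq] := H N; exists q => //.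
by rewrite -updnC 1?eq_sym //; exact: zq.
Qed.

(** Parameters pass from natural to real values one at a time, highest index first. *)
Let zeros_eq0 k s t x : (forall i, (k <= i)%N -> t i = s i) ->
  zeros k s x -> F x t = 0.
Proof.
elim: k s => [|k IH] s ts /=.
  by rewrite (_ : t = s) //; apply/funext => i; apply: ts.
move=> zx; apply: (IH (updn s k (t k))) => [i|].
  rewrite /updn leq_eqVlt => /orP[/eqP <-|ki]; first by rewrite eqxx.
  by rewrite gtn_eqF // ts.
by apply: zeros_poly => // N; exists N => //; exact: zx.
Qed.

(* Taking [D] successive limits superior preserves the lower bound [c]. *)
Lemma polynomial_family_zeros (D : nat) c :
  (forall s, (c <= mu [set x | F x s = 0%R])%E) ->
  exists Z, [/\ measurable Z, (c <= mu Z)%E & forall x, Z x -> forall t,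
    (forall i, (D <= i)%N -> t i = 0) -> F x t = 0].
Proof.
move=> Fc; exists (zeros D (fun=> 0)); split => //.
  move: (fun=> 0) => s; elim: D s => [|k IH] s //=.
  apply: measure_bigcap_infinitely_often => // x io r.
  exact: zeros_poly.
by move=> x zx t t0; apply: zeros_eq0 zx.
Qed.

End PolynomialFamilies.

(** * The joint law determined by a Markov kernel *)

Section KernelJoint.
Context d1 d2 d3 (Om : measurableType d1) (X : measurableType d2)
  (Y : measurableType d3) (R : realType) (P : probability Om R).
Variables (f : Om -> X) (g : Om -> Y) (K : R.-pker X ~> Y).
Hypotheses (mf : measurable_fun setT f) (mg : measurable_fun setT g).
Hypothesis fgK : forall (A : set X) (B : set Y), measurable A -> measurable B ->
  P ((f @^-1` A) `&` (g @^-1` B)) = (\int[P]_(w in f @^-1` A) K (f w) B)%E.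

(** The joint law of [f] and [g] as computed fibrewise from the kernel. *)
Let m2 (C : set (X * Y)) : \bar R := (\int[P]_w K (f w) (xsection C (f w)))%E.

Let m2_meas C : measurable C ->
  measurable_fun setT (fun w => K (f w) (xsection C (f w))).
Proof.
move=> mC; apply: (measurableT_comp (measurable_fun_xsection_finite_kernel K _)) => //.
by rewrite inE.
Qed.

Let m20 : m2 set0 = 0.
Proof. by rewrite /m2 integral0_eq // => w _; rewrite xsection0 measure0. Qed.

Let m2_ge0 C : (0 <= m2 C)%E.
Proof. by apply: integral_ge0 => w _; exact: measure_ge0. Qed.

Let m2_additive : semi_sigma_additive m2.
Proof.
move=> C mC tC mUC.
rewrite [X in _ --> X](_ : _ = (\sum_(n <oo) m2 (C n))%E).
  apply/cvg_closeP; split; last by rewrite closeE.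
  by apply: is_cvg_nneseries => *; exact: m2_ge0.
rewrite -integral_nneseries //; last by move=> n; exact: m2_meas.
apply: eq_integral => w _; apply/esym/cvg_lim => //=; rewrite xsection_bigcup.
apply: (measure_sigma_additive _ (trivIset_xsection tC)) => ?.
exact: measurable_xsection.
Qed.

HB.instance Definition _ := isMeasure.Build _ _ _ m2 m20 m2_ge0 m2_additive.

Let fg (w : Om) : X * Y := (f w, g w).

(** Both sides are finite measures that agree on rectangles, which are stable under intersection and
    generate the product sigma-algebra. *)
Lemma kernel_joint (C : set (X * Y)) : measurable C ->
  P [set w | C (f w, g w)] = (\int[P]_w K (f w) (xsection C (f w)))%E.
Proof.
move=> mC; have mfg : measurable_fun setT fg by exact: measurable_fun_pair.
change (pushforward P fg C = m2 C).
apply: (measure_unique [set A `*` B | A in measurable & B in measurable]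
  (fun=> setT)) => //.
- exact: measurable_prod_measurableType.
- move=> _ _ [X1 mX1 [X2 mX2 <-]] [Y1 mY1 [Y2 mY2 <-]].
  exists (X1 `&` Y1); first exact: measurableI.
  by exists (X2 `&` Y2); [exact: measurableI|rewrite setXI].
- by move=> _; exists setT => //; exists setT => //; rewrite setXTT.
- by apply/seteqP; split => // x _; exists 0%N.
- move=> _ [A mA [B mB <-]].
  transitivity (P ((f @^-1` A) `&` (g @^-1` B))); first by [].
  rewrite fgK // integral_mkcond; apply: eq_integral => w _.
  rewrite /patch; have [wA|wA] := boolP (w \in f @^-1` A).
    by rewrite in_xsectionX //; move: wA; rewrite !inE.
  by rewrite notin_xsectionX ?measure0 //; move: wA; rewrite !notin_setE.
- by move=> _; change (P setT < +oo)%E; rewrite probability_setT ltry.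
Qed.

Lemma kernel_joint_ae (C : set (X * Y)) : measurable C ->
  (forall x, K x (xsection C x) = 0) -> {ae P, forall w, ~ C (f w, g w)}.
Proof.
move=> mC KC; have mfg : measurable_fun setT fg by exact: measurable_fun_pair.
have mS : measurable [set w | C (f w, g w)].
  by have := mfg measurableT C mC; rewrite setTI.
apply: (@negligibleS _ _ _ _ [set w | C (f w, g w)]).
  by move=> w /= /contrapT.
have S0 : P [set w | C (f w, g w)] = 0%E by rewrite kernel_joint // integral0_eq.
exact/negligibleP.
Qed.

End KernelJoint.

(** * Uniform law on a sphere *)

Section UniformSphere.
Variables (R : realType) (d : nat).
Implicit Types (ws : seq 'rV[R]_d) (x y a : 'rV[R]_d).

Definition coord_rV (f : 'rV[R]_d -> R) : Prop := exists k, f = fun x => x ord0 k.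

Lemma coord_rV_polyvec : polyvec coord_rV id.
Proof. by move=> k; apply: polyfun_gen; exists k. Qed.

Lemma coord_rV_comp Y (D : (Y -> R) -> Prop) (g : Y -> 'rV[R]_d) :
  polyvec D g -> forall h, coord_rV h -> polyfun D (h \o g).
Proof. by move=> Pg h [k ->]; exact: Pg. Qed.

Lemma coord_rV_measurable h : coord_rV h -> measurable_fun [set: 'rV[R]_d] h.
Proof. by move=> [k ->]; exact: measurable_coord_rV. Qed.

Lemma orthogonal_complementP ws x :
  orthogonal_complement ws x <-> forall w, w \in ws -> dot w x = 0.
Proof.
split=> [xS w /memv_span|xS w]; first exact: xS.
rewrite -[ws]/(tval (in_tuple ws)) => /coord_span ->.
rewrite dot_suml big1 // => i _; rewrite dotZl xS ?mulr0 //.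
exact: mem_nth.
Qed.

(** A linear parametrization of the complement, so that a polynomial family of points can run
    through it. *)
Lemma orthogonal_complement_range ws : exists B : 'M[R]_d,
  forall x, orthogonal_complement ws x <-> exists t : 'rV[R]_d, x = t *m B.
Proof.
pose A : 'M[R]_(size ws, d) := \matrix_(i, k) (ws`_i) ord0 k.
have SA x : orthogonal_complement ws x <-> x *m A^T = 0.
  rewrite orthogonal_complementP; split=> [xS|xA w /(nthP 0) [i iws <-]].
    apply/rowP => i; rewrite !mxE -[RHS](xS ws`_i) ?mem_nth // dotC.
    by apply: eq_bigr => k _; rewrite !mxE.
  have /rowP/(_ (Ordinal iws)) := xA; rewrite !mxE dotC => xi; rewrite -[RHS]xi.
  by apply: eq_bigr => k _; rewrite !mxE.
exists (kermx A^T) => x; rewrite SA; split=> [/sub_kermxP/submxP//|[t ->]].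
by apply/sub_kermxP; apply/submxP; exists t.
Qed.

(** The reflection that sends [a] to its opposite, acting on row vectors from the right; it is the
    identity when [a] is zero. *)
Definition householder a : 'M[R]_d := 1%:M - (2 / dot a a) *: (a^T *m a).

Lemma mul_householder x a :
  x *m householder a = x - (2 / dot a a * dot x a) *: a.
Proof.
rewrite /householder mulmxBr mulmx1 -scalemxAr mulmxA.
rewrite [x *m a^T]mx11_scalar -dot_mulmx mul_scalar_mx.
by rewrite scalerA.
Qed.

Lemma householderK x a : x *m householder a *m householder a = x.
Proof.
have [->|a0] := eqVneq a 0.
  by rewrite /householder mulmx0 scaler0 subr0 !mulmx1.
rewrite !mul_householder dotBl dotZl -addrA -opprD -scalerDl.
rewrite (_ : 2 / dot a a * dot x a + _ = 0) ?scale0r ?subr0 //.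
have aa : dot a a != 0 by rewrite dot_eq0.
by field.
Qed.

(** The matrix is a symmetric involution. *)
Lemma householder_orthogonal a : householder a *m (householder a)^T = 1%:M.
Proof.
have -> : (householder a)^T = householder a.
  by rewrite /householder linearB /= linearZ /= trmx1 trmx_mul trmxK.
apply/row_matrixP => i; rewrite !rowE mulmxA mulmx1; exact: householderK.
Qed.

Lemma householder_preserves ws a : orthogonal_complement ws a ->
  mulmxr (householder a) @` orthogonal_complement ws = orthogonal_complement ws.
Proof.
move=> aS; have HS x : orthogonal_complement ws x ->
    orthogonal_complement ws (x *m householder a).
  move=> xS w wws; rewrite mul_householder dotBr dotZr.
  by rewrite (xS w wws) (aS w wws) mulr0 subr0.
apply/seteqP; split => [_ [x xS <-]|x xS]; first exact: HS.
by exists (x *m householder a); [exact: HS|exact: householderK].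
Qed.

(* By invariance, all the sets of x such that f vanishes at the reflection of x
   along a have the same measure.  When a runs through a grid of points of S, a
   unit vector lying in too many of them would make f vanish identically. *)
Lemma uniform_sphere_zeros ws (mu : {measure set 'rV[R]_d -> \bar R}) f y :
  mu setT = 1%E -> uniform_on_unit_sphere (orthogonal_complement ws) mu ->
  polyfun coord_rV f -> (forall x s, s != 0 -> f x <> 0 -> f (s *: x) <> 0) ->
  orthogonal_complement ws y -> f y <> 0 -> mu [set x | f x = 0] = 0%E.
Proof.
move=> mu1; set S := orthogonal_complement ws => -[muS mu_inv] Pf fZ yS fy.
have SD u w : S u -> S w -> S (u + w).
  by move=> uS wS z zws; rewrite dotDr uS // wS // addr0.
have SZ c u : S u -> S (c *: u) by move=> uS z zws; rewrite dotZr uS // mulr0.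
have mZ : measurable [set x | f x = 0].
  have := measurableC (measurable_polyfun_neq0 coord_rV_measurable Pf).
  by congr (measurable _); apply/seteqP; split => x /= ; [exact: contrapT|move=> ->].
have [B BS] := orthogonal_complement_range ws.
have mSphere : measurable (unit_sphere S).
  have -> : unit_sphere S = [set x | dot x x = 1] `&`
      \bigcap_(i : nat) [set x | dot ws`_i x = 0].
    apply/seteqP; split=> x [].
      move=> xS x1; split => // i _ /=; have [iws|wsi] := ltnP i (size ws).
        by apply: xS; apply: memv_span; apply: mem_nth.
      by rewrite nth_default // dot0l.
    move=> x1 xS; split => //; apply/orthogonal_complementP => w /(nthP 0) [i iws <-].
    exact: xS.
  have mpol g c : polyfun coord_rV g -> measurable [set x | g x = c].
    move=> Pg; have := polyfun_measurable coord_rV_measurable Pg.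
    by move=> /(_ measurableT [set c] (measurable_set1 c)); rewrite setTI.
  apply: measurableI.
    by apply: mpol; apply: polyfun_dot; exact: coord_rV_polyvec.
  apply: bigcapT_measurable => i; apply: mpol.
  by apply: polyfun_dot; [exact: polyvec_cst|exact: coord_rV_polyvec].
have [x1 [x1S x11]] : unit_sphere S !=set0.
  apply/set0P; apply/eqP => S0; move: muS; rewrite S0 measure0 => /eqP.
  by rewrite eqe eq_sym oner_eq0.
(* Normalizing [y] gives [z]. If [y] is zero, it is first moved along [x1] to a nonzero point where
   [f] still does not vanish. *)
have [z [zS z1 fz]] : exists z, [/\ S z, dot z z = 1 & f z <> 0].
  have [u [uS u0 fu]] : exists u, [/\ S u, u != 0 & f u <> 0].
    have [y0|y0] := eqVneq y 0; last by exists y.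
    have oline : zopen (eq id) (fun t : R => f (t *: x1) <> 0).
      exists (f \o (fun t : R => t *: x1)) => //.
      apply: polyfun_comp Pf; apply: coord_rV_comp; apply: polyvecZ.
        exact: polyfun_gen.
      exact: polyvec_cst.
    have [|N HN] := zopen_univ (a := 0) oline; first by rewrite scale0r -y0.
    exists (N.+1%:R *: x1); split; [exact: SZ| |exact: HN].
    rewrite scaler_eq0 pnatr_eq0 /= -dot_eq0 x11; exact: oner_neq0.
  have uu : 0 < dot u u by rewrite lt_neqAle dot_ge0 eq_sym dot_eq0 u0.
  have s0 : (Num.sqrt (dot u u))^-1 != 0 by rewrite invr_eq0 gt_eqF ?sqrtr_gt0.
  exists ((Num.sqrt (dot u u))^-1 *: u); split; [exact: SZ| |exact: fZ].
  rewrite dotZl dotZr mulrA -expr2 exprVn sqr_sqrtr ?dot_ge0 // mulVf //.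
  by rewrite gt_eqF.
pose A (s : nat -> R) : 'rV[R]_d := (\row_k s k) *m B.
have AS s : S (A s) by apply/BS; eexists.
(* The argument of [f] is the reflection of [x] along [A s], with its denominator cleared so as to
   be polynomial in [s]. The outer factor makes [F] vanish when [A s] is zero, so that the measure
   bound holds there too. *)
pose F x s := dot (A s) (A s) * f (dot (A s) (A s) *: x - (2 * dot x (A s)) *: A s).
have F_meas s : measurable [set x | F x s = 0].
  have PF : polyfun coord_rV (F^~ s).
    apply: polyfun_mul; first exact: polyfun_cst.
    apply: (polyfun_comp _ Pf); apply: coord_rV_comp; apply: polyvecB.
      by apply: polyvecZ; [exact: polyfun_cst|exact: coord_rV_polyvec].
    apply: polyvecZ; last exact: polyvec_cst.
    apply: polyfun_mul; first exact: polyfun_cst.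
    by apply: polyfun_dot; [exact: coord_rV_polyvec|exact: polyvec_cst].
  have := polyfun_measurable coord_rV_measurable PF.
  by move=> /(_ measurableT [set 0] (measurable_set1 0)); rewrite setTI.
have F_poly x s k : polyfun (eq id) (fun t => F x (fun i => if i == k then t else s i)).
  have PA : polyvec (eq id) (fun t => A (fun i => if i == k then t else s i)).
    move=> j; apply: (@eq_polyfun _ _ _
      (fun t => \sum_i (if nat_of_ord i == k then t else s i) * B i j)).
      by move=> t; rewrite mxE; apply: eq_bigr => i _; rewrite mxE.
    apply: polyfun_sum => i _; apply: polyfun_mul; last exact: polyfun_cst.
    by case: eqP => _; [exact: polyfun_gen|exact: polyfun_cst].
  apply: polyfun_mul; first exact: polyfun_dot.
  apply: (polyfun_comp _ Pf); apply: coord_rV_comp; apply: polyvecB.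
    by apply: polyvecZ; [exact: polyfun_dot|exact: polyvec_cst].
  apply: polyvecZ => //; apply: polyfun_mul; first exact: polyfun_cst.
  by apply: polyfun_dot => //; exact: polyvec_cst.
have Fc s : (mu [set x | f x = 0%R] <= mu [set x | F x s = 0%R])%E.
  have [A0|A0] := eqVneq (A s) 0.
    apply: le_measure; rewrite ?inE // => x _ /=.
    by rewrite /F A0 dot0l mul0r.
  have D0 : dot (A s) (A s) != 0 by rewrite dot_eq0.
  have E : mulmxr (householder (A s)) @^-1` [set x | f x = 0] =
      [set x | F x s = 0].
    have FE x : F x s = dot (A s) (A s) *
        f (dot (A s) (A s) *: (x *m householder (A s))).
      rewrite /F mul_householder scalerBr scalerA; congr (_ * f (_ - _ *: _)).
      by rewrite mulrA mulrCA divff // mulr1.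
    apply/seteqP; split=> x /= => [f0|/eqP].
      rewrite FE; apply/eqP; rewrite mulf_eq0 (negPf D0) /=; apply/eqP.
      apply: contrapT => /(fZ _ (dot (A s) (A s))^-1); apply.
        by rewrite invr_eq0.
      by rewrite scalerA mulVf // scale1r.
    rewrite FE mulf_eq0 (negPf D0) /= => /eqP f0.
    by apply: contrapT => /(fZ _ (dot (A s) (A s))); exact.
  rewrite -E mu_inv //; first exact: householder_orthogonal.
  exact: (householder_preserves (AS s)).
have mu_fin : (mu setT < +oo)%E by rewrite mu1 ltry.
have [Z [mZ' muZ Z0]] := polynomial_family_zeros mu_fin F_meas F_poly d Fc.
(* [Z] is at least as large as the zero set of [f]; it remains to show that it misses the sphere. *)
apply/eqP; rewrite eq_le measure_ge0 andbT; apply: le_trans muZ _.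
have SC0 : mu (~` unit_sphere S) = 0%E.
  have -> : mu (~` unit_sphere S) = (mu setT - mu (unit_sphere S))%E.
    rewrite -setTD measureD //; first by rewrite setTI.
  by rewrite mu1 muS subee.
rewrite -SC0; apply: le_measure; rewrite ?inE //; first exact: measurableC.
(* A unit vector of S is mapped to z or -z by some reflection in the family. *)
move=> x Zx [xS xx].
have Fa a : S a -> a != 0 -> f (dot a a *: x - (2 * dot x a) *: a) = 0.
  move=> /BS [t aE] a0; pose s k := if insub k is Some i then t ord0 i else 0.
  have As : A s = a.
    rewrite aE /A; congr (_ *m _); apply/rowP => k; rewrite mxE /s.
    by rewrite insubT //= => kd; congr (t _ _); apply: val_inj.
  have := Z0 x Zx s; rewrite /F As => /(_ _)/eqP.
  rewrite mulf_eq0 dot_eq0 (negPf a0) /= => H; apply/eqP; apply: H => i di.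
  by rewrite /s insubF // ltnNge di.
have [xz|xz] := eqVneq x z.
  have := Fa x xS; rewrite -dot_eq0 xx oner_eq0 => /(_ isT).
  rewrite mulr1 -scalerBl xz; apply: fZ fz.
  by rewrite (_ : 1 - 2 = -1) ?oppr_eq0 ?oner_eq0 //; ring.
have aS : S (x - z) by rewrite -scaleN1r; apply: SD => //; exact: SZ.
have a0 : x - z != 0 by rewrite subr_eq0.
have := Fa _ aS a0; have : dot (x - z) (x - z) != 0 by rewrite dot_eq0.
rewrite (_ : dot (x - z) (x - z) *: x - _ = dot (x - z) (x - z) *: z).
  by move=> D0; apply: fZ.
(* This uses that [x] and [z] have equal length, so that reflection along [x - z] exchanges them. *)
have -> : 2 * dot x (x - z) = dot (x - z) (x - z).
  by rewrite !dotBl !dotBr xx z1 (dotC z x); ring.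
by rewrite scalerBr opprB addrC subrK.
Qed.

End UniformSphere.

(** * Uniform LSS *)

Section LSS.
Variables (T : finType) (e : rel T) (n : nat) (v : 'I_n -> T).

Definition nonneighbours (j : 'I_n) : {set 'I_n} :=
  [set i : 'I_n | (i < j)%N && ~~ e (v i) (v j)]%SET.

Lemma nonneighbours_lt i j : i \in nonneighbours j -> (i < j)%N.
Proof. by rewrite inE => /andP[]. Qed.

Lemma map_earlier_nonneighbours (j : 'I_n) :
  let s := map (@earlier n j) (earlier_nonneighbours e v j) in
  uniq s /\ s =i nonneighbours j.
Proof.
split.
  rewrite map_inj_uniq; first by apply: filter_uniq; apply: enum_uniq.
  by move=> i k /(congr1 val) ik; apply: val_inj.
move=> i; rewrite !inE; apply/mapP/andP => [[k + ->]|[ij eij]].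
  by rewrite mem_filter => /andP[ek _]; split => //=.
have E : i = earlier (Ordinal ij) by apply: val_inj.
by exists (Ordinal ij) => //; rewrite mem_filter -E eij mem_enum.
Qed.

Lemma free_indep (R : realType) d (x : 'I_n -> 'rV[R]_d) (s : seq 'I_n) :
  uniq s -> indep x [set i in s]%SET -> free (map x s).
Proof.
move=> us xs; rewrite -[map x s]/(tval (map_tuple x (in_tuple s))).
apply/freeP => k kx l.
(* For [i] outside [s] the index equals the size of [s], so [insub] fails and the coefficient is
   zero. *)
pose c i := if insub (index i s) is Some q then k q else 0.
have cE q : c (tnth (in_tuple s) q) = k q.
  rewrite /c (tnth_nth (tnth (in_tuple s) q)) /= index_uniq //.
  by rewrite insubT //= => qs; congr (k _); apply: val_inj.
rewrite -cE; apply: xs => [i|].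
  by rewrite inE => si; rewrite /c insubF // index_mem (negPf si).
rewrite (bigID (fun i => i \in s)) /= [X in _ + X]big1 ?addr0; last first.
  by move=> i si; rewrite /c insubF ?scale0r // index_mem (negPf si).
rewrite -big_uniq // big_tnth -[RHS]kx; apply: eq_bigr => q _.
by rewrite cE (nth_map (tnth (in_tuple s) q)) // -tnth_nth.
Qed.

Context (R : realType) (d : nat) (disp : measure_display)
  (Omega : measurableType disp) (P : probability Omega R)
  (phi : 'I_n -> {RV P >-> 'rV[R]_d}).

Let config (omega : Omega) : 'I_n -> 'rV[R]_d := fun i => phi i omega.

Lemma past_measurable j : measurable_fun setT (past phi j).
Proof.
apply/measurable_fun_tnthP => i.
rewrite (_ : _ \o _ = phi (earlier i)); first exact: measurable_funP.
by apply/funext => w /=; rewrite /past tnth_mktuple.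
Qed.

(** Padding with zeros lets conditions on full families be evaluated on a history. *)
Definition extend_history (j : 'I_n) (h : j.-tuple 'rV[R]_d) : 'I_n -> 'rV[R]_d :=
  fun i => if insub (nat_of_ord i) is Some k then tnth h k else 0.

Lemma extend_history_earlier (j : 'I_n) (h : j.-tuple 'rV[R]_d) k :
  extend_history h (earlier k) = tnth h k.
Proof.
by rewrite /extend_history insubT //= => kj; congr tnth; apply: val_inj.
Qed.

Lemma extend_past (j i : 'I_n) omega : (i < j)%N ->
  extend_history (past phi j omega) i = phi i omega.
Proof.
move=> ij; have -> : i = earlier (Ordinal ij) by apply: val_inj.
by rewrite extend_history_earlier tnth_mktuple.
Qed.

Lemma measurable_extend_history (j i : 'I_n) k :
  measurable_fun [set: j.-tuple 'rV[R]_d] (fun h => extend_history h i ord0 k).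
Proof.
rewrite /extend_history; case: insubP => [q _ _|_]; last exact: measurable_cst.
apply: (measurableT_comp (f := fun x : 'rV[R]_d => x ord0 k)).
  exact: measurable_coord_rV.
exact: measurable_tnth.
Qed.

Hypothesis phi_LSS : uniform_LSS e v phi.

(** Given the history, [extends] exhibits a point of the complement of [W_j] at which [U] holds, so
    the uniform law gives mass zero to the failure of [U]. The statement is a null event for history
    and new vector jointly, as [kernel_joint_ae] requires. *)
Lemma LSS_step (j : 'I_n) U y : (#|nonneighbours j| < d)%N ->
  zopen (@coord_fun R n d) U -> rescalable U ->
  {ae P, forall omega,
    ~ (extends nonneighbours U j y (extend_history (past phi j omega)) /\
       ~ U (upd (extend_history (past phi j omega)) j (phi j omega)))}.
Proof.
move=> Wd oU sU; have [K [Klaw Kjoint]] := phi_LSS j.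
pose D := [set p : j.-tuple 'rV[R]_d * 'rV[R]_d |
  extends nonneighbours U j y (extend_history p.1) /\
  ~ U (upd (extend_history p.1) j p.2)].
apply: (@kernel_joint_ae _ _ _ _ _ _ _ _ (past phi j) (phi j) K _ _ _ D).
- exact: past_measurable.
- exact: measurable_funP.
- exact: Kjoint.
(* Taking all measurable functions as generators makes the two open conditions on the pair
   measurable. *)
- have ext1 i : polyvec (fun f => measurable_fun [set: j.-tuple 'rV[R]_d * 'rV[R]_d] f)
      (fun p => extend_history p.1 i).
    move=> k; apply: polyfun_gen.
    apply: (measurableT_comp (f := fun h => extend_history h i ord0 k)) => //.
    exact: measurable_extend_history.
  have ext2 : polyvec (fun f => measurable_fun [set: j.-tuple 'rV[R]_d * 'rV[R]_d] f)
      (fun p => p.2).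
    move=> k; apply: polyfun_gen.
    apply: (measurableT_comp (f := fun x : 'rV[R]_d => x ord0 k)) => //.
    exact: measurable_coord_rV.
  apply: measurableI; last first.
    apply: measurableC; apply: (@measurable_zopen _ _ _ _ _ (fun h mh => mh)).
    exact: zopen_upd.
  apply: (@measurable_zopen _ _ _ _ _ (fun h mh => mh)).
  apply: (@zopen_comp _ _ _ _ _ (fun p => extend_history p.1)).
    exact: coord_comp.
  exact: zopen_extends.
(* Histories at which [extends] fails have an empty section. *)
move=> h; have [[hW Uh]|nh] :=
    pselect (extends nonneighbours U j y (extend_history h)); last first.
  rewrite (_ : xsection _ _ = set0) ?measure0 //.
  by apply/seteqP; split => // z; rewrite /xsection /= inE => -[].
have [us sE] := map_earlier_nonneighbours j.
have wsE : [seq tnth h i | i <- earlier_nonneighbours e v j] =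
    map (extend_history h) (map (@earlier n j) (earlier_nonneighbours e v j)).
  by rewrite -map_comp; apply: eq_map => i /=; rewrite extend_history_earlier.
have sizews : (size [seq tnth h i | i <- earlier_nonneighbours e v j] < d)%N.
  rewrite wsE size_map; move: Wd; rewrite -(eq_card sE) (card_uniqP us) //.
have := Klaw h; rewrite /lss_step_law leqNgt sizews orbF wsE.
rewrite free_indep //=; last first.
  rewrite (_ : [set i in _]%SET = nonneighbours j) //.
  by apply/setP => i; rewrite inE sE.
move=> unif.
have [f Pf Uf] : zopen (@coord_rV R d) (fun z => U (upd (extend_history h) j z)).
  apply: (@zopen_upd _ _ _ _ _ _ (fun=> extend_history h)) => //.
    by move=> i; exact: polyvec_cst.
  exact: coord_rV_polyvec.
rewrite (_ : xsection _ _ = [set z | f z = 0]); last first.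
  apply/seteqP; split => z; rewrite /xsection /= inE /D /=.
    by move=> [_ nU]; apply: contrapT => /Uf.
  by move=> fz; split => // /Uf.
apply: (uniform_sphere_zeros (prob_kernel h) unif Pf _ _ ((Uf _).1 Uh)).
- move=> z s s0 /Uf Uz; apply/Uf.
  rewrite (_ : upd _ _ _ = fun i => (if i == j then s else 1) *:
                                upd (extend_history h) j z i).
    by apply: sU => // i; case: ifP => // _; exact: oner_neq0.
  by apply/funext => i; rewrite /upd; case: eqP => // _; rewrite scale1r.
- apply/orthogonal_complementP => w /mapP[i]; rewrite sE => iW ->.
  by rewrite dotC gram_proj_orth.
Qed.

(** The given representation supplies a [y] for which [extends] is met by a shorter representation;
    by induction it then holds almost surely, and [LSS_step] passes from it to [U]. *)
Lemma LSS_generic m U : (m <= n)%N ->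
  (forall i : 'I_n, (i < m)%N -> (#|nonneighbours i| < d)%N) ->
  zopen (@coord_fun R n d) U -> rescalable U -> depends m U ->
  (exists2 x, representation nonneighbours m x & U x) ->
  {ae P, forall omega, U (config omega)}.
Proof.
elim: m U => [|m IH] U mn Wd oU sU dU [x xm Ux].
  by apply: aeW => w; apply: dU Ux.
pose j := Ordinal mn; pose y := (\det (gram x (nonneighbours j)))^-1 *: x j.
have dE : depends m (extends nonneighbours U j y).
  by apply: (extends_depends nonneighbours_lt (m := j)).
have ext_ae : {ae P, forall omega, extends nonneighbours U j y (config omega)}.
  apply: IH; [exact: ltnW| |exact: zopen_extends|exact: extends_rescalable|exact: dE|].
    by move=> i im; apply: Wd; apply: ltnW.
  exists x; first exact: representation_le xm.
  exact: (extends_self (m := j)).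
apply: filterS2 ext_ae (LSS_step y (Wd j (ltnSn m)) oU sU) => w lw nw.
apply: contrapT => nU; apply: nw; split.
  by apply: dE lw => i im; rewrite extend_past.
move=> Uw; apply: nU; apply: dU Uw => i; rewrite ltnS leq_eqVlt.
move=> /orP[/eqP im|im].
  by rewrite (_ : i = j) ?upd_same //; apply: val_inj.
by rewrite upd_lt // extend_past.
Qed.

End LSS.

(** * Counting non-neighbours in a greedy ordering *)

Section GreedyCounting.
Variables (T : finType) (e : rel T) (n : nat) (v : 'I_n -> T).

(** The [i] positions below [i] split into non-neighbours and neighbours of [v j]. *)
Lemma card_nonneighbours_lt (i j : 'I_n) : (i <= j)%N ->
  (#|[set h in nonneighbours e v j | (h < i)%N]%SET| + local_degree e v i j)%N = i.
Proof.
move=> ij; have ci : #|[set h : 'I_n | (h < i)%N]%SET| = i.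
  rewrite -[RHS]card_ord -(card_imset _ (f := @earlier n i)); last first.
    by move=> h k /(congr1 val) hk; apply: val_inj.
  apply: eq_card => h; rewrite inE; apply/idP/imsetP => [hi|[k _ ->]].
    by exists (Ordinal hi) => //; apply: val_inj.
  exact: (ltn_ord k).
rewrite -[RHS]ci -(cardsID [set h | e (v h) (v j)]%SET) addnC /local_degree.
congr (_ + _)%N; apply: eq_card => h; rewrite !inE.
  by rewrite andbC.
by have [hi|] := ltnP h i; rewrite ?andbF // (leq_trans hi ij) andbT.
Qed.

(** Counted among the positions below [i], non-neighbours complement the local degree, so the greedy
    inequality is reversed. *)
Lemma greedy_nonneighbours : greedy_ordering e v -> forall i j : 'I_n,
  (i <= j)%N -> (#|nonneighbours e v i| <=
    #|[set h in nonneighbours e v j | (h < i)%N]%SET|)%N.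
Proof.
move=> gr i j ij; rewrite -(leq_add2r (local_degree e v i j)).
rewrite (card_nonneighbours_lt ij) -[X in (_ <= X)%N](card_nonneighbours_lt (leqnn i)).
apply: leq_add; last exact: gr.
apply: subset_leq_card; apply/fintype.subsetP => h.
by rewrite !inE => /andP[-> ->].
Qed.

End GreedyCounting.

(** By irreflexivity all neighbours of the last vertex precede it, so its local degree is its
    degree. *)
Lemma card_nonneighbours_last (T : finType) (e : rel T) n (v : 'I_n.+1 -> T) :
  symmetric e -> irreflexive e -> bijective v ->
  (#|nonneighbours e v ord_max| + degree e (v ord_max))%N = n.
Proof.
move=> sym irr v_bij; rewrite -[RHS](card_nonneighbours_lt e v (leqnn ord_max)).
congr (_ + _)%N; first by apply: eq_card => h; rewrite !inE andbAC andbb.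
have := on_card_preimset (onW_bij [set y | e (v ord_max) y]%SET v_bij).
rewrite /degree /local_degree => <-.
apply: eq_card => h; rewrite !inE sym.
have [->|hm] := eqVneq h ord_max; first by rewrite irr andbF.
have -> // : (h < (ord_max : 'I_n.+1))%N.
rewrite ltn_neqAle -[X in _ && X]ltnS ltn_ord andbT.
by apply: contra hm => /eqP hn; apply/eqP; apply: val_inj.
Qed.

(** [LSS_generic] reduces each claim to one suitable representation, supplied by
    [representation_indep]. *)
Theorem mainTheorem1 (R : realType) (T : finType) (e : rel T)
    (e_sym : symmetric e) (e_irr : irreflexive e)
    (n : nat) (v : 'I_n.+1 -> T) (v_bij : bijective v)
    (v_greedy : greedy_ordering e v)
    (disp : measure_display) (Omega : measurableType disp)
    (P : probability Omega R)
    (phi : 'I_n.+1 -> {RV P >-> 'rV[R]_(n.+1 - degree e (v ord_max))})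
    (phi_LSS : uniform_LSS e v phi) :
  succeeds_strongly e v phi.
Proof.
move: phi phi_LSS; set d := (n.+1 - _)%N => phi phi_LSS.
pose W := nonneighbours e v.
have W_lt : forall i j, i \in W j -> (i < j)%N := @nonneighbours_lt _ e _ v.
have W_greedy := greedy_nonneighbours v_greedy.
(* Greediness bounds [#|W j|] by [#|W ord_max|], which equals [d - 1]. *)
have Wd j : (#|W j| < d)%N.
  have := W_greedy j ord_max (leq_ord j).
  have := card_nonneighbours_last e_sym e_irr v_bij.
  have : (#|[set h in W ord_max | (h < j)%N]%SET| <= #|W ord_max|)%N.
    by apply: subset_leq_card; apply/fintype.subsetP => h; rewrite inE => /andP[].
  rewrite /d /W; lia.
split.
  apply: filter_forall => j.
  apply: (LSS_generic phi_LSS (m := j.+1) (U := fun x => x j != 0)) => //.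
  - exists (fun x => dot (x j) (x j)).
      by apply: polyfun_dot; exact: coord_polyvec.
    by move=> x; rewrite -dot_eq0; split => /eqP.
  - by move=> x s s0 xj; rewrite scaler_eq0 negb_or s0.
  - by move=> x y xy; rewrite xy.
  (* As [#|W j| < d], a nonzero vector orthogonal to the independent [W j] fits at position [j]. *)
  - have [x xj xW] := representation_indep R W_lt W_greedy (ltnW (ltn_ord j))
      (admissible_W W_lt W_greedy j) (ltnW (Wd j)) (fun i _ => Wd i).
    have [z z0 zW] := orth_exists x (Wd j).
    exists (upd x j z); last by rewrite upd_same.
    exact: representationS.
move=> i j ij eij.
have iW : i \notin W j by rewrite inE eij andbF.
have aA : admissible W j (i |: W j).
  split=> [h|h hj].
    by rewrite !inE => /orP[/eqP -> //|/andP[]].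
  apply: leq_trans ((admissible_W W_lt W_greedy j).2 h hj) _.
  apply: subset_leq_card; apply/fintype.subsetP => k; rewrite !inE.
  by move=> /andP[-> ->]; rewrite orbT.
have Ad : (#|i |: W j| <= d)%N by rewrite cardsU1 iW.
have [us sE] := map_earlier_nonneighbours e v j.
(* The condition involves only positions below [j], so representations up to [j] are enough. *)
have gen : {ae P, forall omega, indep (fun k => phi k omega) (i |: W j)}.
  apply: (LSS_generic phi_LSS (m := j) (U := fun x => indep x (i |: W j))) => //.
  - exact: ltnW.
  - exact: zopen_indep.
  - by move=> x s; exact: indep_scale.
  - by apply: indep_depends; exact: aA.1.
  - have [x xj xA] := representation_indep R W_lt W_greedy (ltnW (ltn_ord j)) aA Ad
      (fun i _ => Wd i).
    by exists x.
apply: filterS gen => omega ind.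
rewrite (_ : rcons _ _ = map (fun k => phi k omega)
    (rcons (map (@earlier n.+1 j) (earlier_nonneighbours e v j)) i)).
  apply: free_indep; first by rewrite rcons_uniq us sE iW.
  rewrite (_ : [set k in _]%SET = i |: W j) //.
  by apply/setP => k; rewrite !inE mem_rcons inE sE inE.
by rewrite map_rcons -map_comp.
Qed.
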